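(* Let $\varGamma$ be a well-oriented modular graph (see context) and let $g:\varGamma\to\mathbf{R}\cup\{\infty\}$ be an L-convex function. Assume that $\varGamma$ is locally finite or that the image of $g$ is discrete (there is $\epsilon>0$ with $[g(x)-\epsilon,g(x)+\epsilon]\cap g(\varGamma)=\{g(x)\}$ for every $x\in\varGamma$). Consider the Steepest Descent Algorithm started at a vertex $x\in\operatorname{dom} g$: Step 1: let $y$ be a minimizer of $g$ over $\mathcal{F}'_x\cup\mathcal{I}'_x$; Step 2: if $g(x)=g(y)$, stop (then $x$ is a minimizer); Step 3: set $x:=y$ and go to Step 1. Let $N$ be the total number of executions of Step 3, and let $\mathrm{opt}(g)$ be the set of minimizers of $g$. Then $N\le d^{\varDelta}(x,\mathrm{opt}(g))+2$, where $d^{\varDelta}(x,\mathrm{opt}(g))=\min_{y\in\mathrm{opt}(g)}d^{\varDelta}(x,y)$. Moreover, if $g(x)=\min_{y\in\mathcal{F}'_x}g(y)$ or $g(x)=\min_{y\in\mathcal{I}'_x}g(y)$ for the initial vertex $x$, then $N=d^{\varDelta}(x,\mathrm{opt}(g))$.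
   Context: All graphs are connected, simple, undirected, possibly infinite; $d$ is the shortest-path metric (uniform edge length) and $I(x,y)=\{z: d(x,z)+d(z,y)=d(x,y)\}$. A graph is modular if $I(x,y)\cap I(y,z)\cap I(z,x)\neq\emptyset$ for all vertices $x,y,z$. An edge-orientation of a modular graph is admissible if for every 4-cycle $(x_1,x_2,x_3,x_4)$, $x_1\to x_2$ implies $x_4\to x_3$. An oriented modular graph $\varGamma$ is a modular graph with an admissible orientation; it is acyclic and $p\preceq q$ means there is a directed path from $q$ to $p$ (so $q\to p$ means $q$ covers $p$). For $p\preceq q$ the interval $[p,q]=\{u:p\preceq u\preceq q\}$ is a modular lattice; write $p\sqsubseteq q$ if $p\preceq q$ and $[p,q]$ is a complemented modular lattice (every element is a join of elements covering $p$). $\varGamma$ is well-oriented if $p\preceq q$ always implies $p\sqsubseteq q$. For a vertex $x$: $\mathcal{F}'_x=\{y:x\sqsubseteq y\}$ ordered by $\preceq$, $\mathcal{I}'_x=\{y:y\sqsubseteq x\}$ ordered by the reverse of $\preceq$; these are modular semilattices with minimum $x$. A $\varDelta'$-path is a sequence $x_0,\dots,x_m$ with $x_i\sqsubseteq x_{i+1}$ or $x_{i+1}\sqsubseteq x_i$ for all $i$; a vertex set is $\varDelta'$-connected if any two distinct vertices of it are joined by a $\varDelta'$-path inside it. The barycentric subdivision $\varGamma^*$ is the poset of all intervals $[x,y]$ with $x\sqsubseteq y$, ordered by reverse inclusion (its covering graph, with half edge length and oriented by covering, is again an oriented modular graph); $\varGamma$ is identified with $\{[x,x]\}\subseteq\varGamma^*$.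 The neighborhood semilattice $\mathcal{I}^*_x$ is the set of $[y,z]\in\varGamma^*$ with $y\preceq x\preceq z$, ordered by inclusion (a modular semilattice with minimum $[x,x]$). For $g:\varGamma\to\mathbf{R}\cup\{\infty\}$, $\operatorname{dom} g=\{x:g(x)<\infty\}$ and $g^*([x,y])=(g(x)+g(y))/2$. $g$ is L-convex if $\operatorname{dom} g$ is $\varDelta'$-connected and for every vertex $x$ the restriction of $g^*$ to $\mathcal{I}^*_x$ is submodular in the following sense. Submodularity: a modular semilattice is a meet-semilattice $\mathcal{L}$ of finite rank (rank function $r$) in which every principal ideal $\{u:u\preceq p\}$ is a modular lattice ($x\wedge(y\vee z)=(x\wedge y)\vee z$ for $x\succeq z$) and $x\vee y\vee z$ exists whenever $x\vee y,y\vee z,z\vee x$ exist. For $p,q\in\mathcal{L}$ let $I(p,q)$ be the set of elements on shortest $p$–$q$ paths in the covering graph of $\mathcal{L}$, $r(u;p,q)=(r(u\wedge p)-r(p\wedge q),\,r(u\wedge q)-r(p\wedge q))$, $\mathrm{Conv}\,I(p,q)$ the convex hull of these vectors, $\mathcal{E}(p,q)$ the set of $u\in I(p,q)$ with $r(u;p,q)$ a componentwise-maximal extreme point of $\mathrm{Conv}\,I(p,q)$, and $C(u;p,q)=\{w\in\mathbf{R}^2_{\ge0}:\langle w,r(u;p,q)\rangle=\max_{z\in\mathrm{Conv}I(p,q)}\langle w,z\rangle\}$, a cone $\{(x,y)\in\mathbf{R}^2_{\ge 0}: y\cos\alpha\le x\sin\alpha,\ y\cos\beta\ge x\sin\beta\}$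 with $0\le\beta\le\alpha\le\pi/2$; set $[C(u;p,q)]=\frac{\sin\alpha}{\sin\alpha+\cos\alpha}-\frac{\sin\beta}{\sin\beta+\cos\beta}$. $f:\mathcal{L}\to\mathbf{R}\cup\{\infty\}$ is submodular if $f(p)+f(q)\ge f(p\wedge q)+\sum_{u\in\mathcal{E}(p,q)}[C(u;p,q)]f(u)$ for all $p,q$ (terms with zero coefficient omitted; $a+\infty=\infty$). Thickening: two vertices $x\neq y$ of $\varGamma$ are $\varDelta$-adjacent if $x,y\in[u,v]$ for some $u\sqsubseteq v$; $\varGamma^{\varDelta}$ is the graph of $\varDelta$-adjacency and $d^{\varDelta}$ is the number of edges of a shortest path in $\varGamma^{\varDelta}$. In Step 1, $y$ may be any minimizer. *)

(* Defs.v *)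
From Stdlib Require Import Reals Lra List Relations.
Open Scope R_scope.

Set Implicit Arguments.

Section Walks.
Variable T : Type.
Variable E : T -> T -> Prop.

Inductive walk : T -> T -> nat -> Prop :=
| walk_nil : forall a, walk a a 0
| walk_cons : forall a b c n, E a b -> walk b c n -> walk a c (S n).

Definition dist (a b : T) (n : nat) : Prop :=
  walk a b n /\ forall m, walk a b m -> (n <= m)%nat.

Definition metric_interval (a b z : T) : Prop :=
  exists n1 n2, dist a z n1 /\ dist z b n2 /\ dist a b (n1 + n2).
End Walks.

Section Graphs.
Variable V : Type.
Variable adj : V -> V -> Prop.

Definition simple_graph : Prop :=
  (forall a b, adj a b -> adj b a) /\ (forall a, ~ adj a a).

Definition connected_graph : Prop := forall a b, exists n, walk adj a b n.

Definition locally_finite : Prop :=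
  forall a, exists l : list V, forall b, adj a b -> In b l.

Definition modular_graph : Prop :=
  forall a b c, exists w,
    metric_interval adj a b w /\ metric_interval adj b c w /\ metric_interval adj c a w.

(* ori a b means the edge ab is oriented a -> b *)
Definition edge_orientation (ori : V -> V -> Prop) : Prop :=
  (forall a b, ori a b -> adj a b) /\
  (forall a b, adj a b -> ori a b \/ ori b a) /\
  (forall a b, ~ (ori a b /\ ori b a)).

Definition four_cycle (x1 x2 x3 x4 : V) : Prop :=
  NoDup (x1 :: x2 :: x3 :: x4 :: nil) /\
  adj x1 x2 /\ adj x2 x3 /\ adj x3 x4 /\ adj x4 x1.

Definition admissible_orientation (ori : V -> V -> Prop) : Prop :=
  edge_orientation ori /\
  forall x1 x2 x3 x4, four_cycle x1 x2 x3 x4 -> ori x1 x2 -> ori x4 x3.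

Definition oriented_modular_graph (ori : V -> V -> Prop) : Prop :=
  simple_graph /\ connected_graph /\ modular_graph /\ admissible_orientation ori.
End Graphs.

Section Oriented.
Variable V : Type.
Variable ori : V -> V -> Prop.

Definition prec (p q : V) : Prop := clos_refl_trans V ori q p.

Definition in_interval (p q u : V) : Prop := prec p u /\ prec u q.

(* p ⊑ q : p <= q and every element of [p,q] is the join (in [p,q]) of
   a set of elements of [p,q] covering p *)
Definition sqle (p q : V) : Prop :=
  prec p q /\
  forall u, in_interval p q u ->
    exists S : V -> Prop,
      (forall a, S a -> ori a p /\ prec a q) /\
      (forall a, S a -> prec a u) /\
      (forall w, in_interval p q w -> (forall a, S a -> prec a w) -> prec u w).

Definition well_oriented : Prop := forall p q, prec p q -> sqle p q.

Definition Fset (x y : V) : Prop := sqle x y.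
Definition Iset (x y : V) : Prop := sqle y x.

Definition delta_adj (a b : V) : Prop :=
  a <> b /\ exists u v, sqle u v /\ in_interval u v a /\ in_interval u v b.

Definition ddist (a b : V) (n : nat) : Prop := dist delta_adj a b n.

Definition delta'_connected (D : V -> Prop) : Prop :=
  forall a b, D a -> D b -> a <> b ->
    clos_refl_trans V (fun u v => D u /\ D v /\ (sqle u v \/ sqle v u)) a b.
End Oriented.

(* Submodularity on a modular semilattice (poset (T, le) with carrier M *)
(* and minimum bot)                                                     *)
Section Submodular.
Variable T : Type.
Variable M : T -> Prop.
Variable le : T -> T -> Prop.
Variable bot : T.

Definition glb (a b m : T) : Prop :=
  M m /\ le m a /\ le m b /\ forall c, M c -> le c a -> le c b -> le c m.

Definition covers (a b : T) : Prop :=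
  M a /\ M b /\ le a b /\ a <> b /\
  forall c, M c -> le a c -> le c b -> c = a \/ c = b.

Definition rank (u : T) (n : nat) : Prop :=
  exists s : nat -> T, s 0%nat = bot /\ s n = u /\
    forall i, (i < n)%nat -> covers (s i) (s (S i)).

Definition cov_adj (a b : T) : Prop := covers a b \/ covers b a.

Definition sl_interval (p q u : T) : Prop :=
  M u /\ metric_interval cov_adj p q u.

Definition rvec (p q u : T) (z : R * R) : Prop :=
  exists mp mq m0 n1 n2 n0,
    glb u p mp /\ glb u q mq /\ glb p q m0 /\
    rank mp n1 /\ rank mq n2 /\ rank m0 n0 /\
    z = (INR n1 - INR n0, INR n2 - INR n0).

Definition rpoints (p q : T) (z : R * R) : Prop :=
  exists u, sl_interval p q u /\ rvec p q u z.

Definition comb (l : list (R * (R * R))) : R * R :=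
  fold_right (fun c acc => (fst c * fst (snd c) + fst acc,
                            fst c * snd (snd c) + snd acc)) (0, 0) l.

Definition weights (l : list (R * (R * R))) : R :=
  fold_right (fun c acc => fst c + acc) 0 l.

Definition conv (P : R * R -> Prop) (z : R * R) : Prop :=
  exists l : list (R * (R * R)),
    (forall c, In c l -> 0 <= fst c /\ P (snd c)) /\
    weights l = 1 /\ z = comb l.

Definition extreme_point (K : R * R -> Prop) (z : R * R) : Prop :=
  K z /\ forall a b t, K a -> K b -> 0 < t < 1 ->
    z = (t * fst a + (1 - t) * fst b, t * snd a + (1 - t) * snd b) -> a = b.

Definition cw_maximal (K : R * R -> Prop) (z : R * R) : Prop :=
  forall z', K z' -> fst z <= fst z' -> snd z <= snd z' -> z' = z.

Definition Eset (p q u : T) : Prop :=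
  sl_interval p q u /\
  exists z, rvec p q u z /\ extreme_point (conv (rpoints p q)) z /\
            cw_maximal (conv (rpoints p q)) z.

Definition dotp (w z : R * R) : R := fst w * fst z + snd w * snd z.

Definition Ccone (p q u : T) (w : R * R) : Prop :=
  0 <= fst w /\ 0 <= snd w /\
  exists z, rvec p q u z /\
    forall z', conv (rpoints p q) z' -> dotp w z' <= dotp w z.

Definition cone_ab (alpha beta : R) (w : R * R) : Prop :=
  0 <= fst w /\ 0 <= snd w /\
  snd w * cos alpha <= fst w * sin alpha /\
  snd w * cos beta >= fst w * sin beta.

Definition coef (p q u : T) (c : R) : Prop :=
  exists alpha beta, 0 <= beta <= alpha /\ alpha <= PI / 2 /\
    (forall w, Ccone p q u w <-> cone_ab alpha beta w) /\
    c = sin alpha / (sin alpha + cos alpha) - sin beta / (sin beta + cos beta).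

(* f : L -> R ∪ {∞} is represented by its domain fdom and its finite
   values fv (fv is irrelevant outside fdom). *)
Definition submodular (fdom : T -> Prop) (fv : T -> R) : Prop :=
  forall p q, M p -> M q -> fdom p -> fdom q ->
    exists m, glb p q m /\ fdom m /\
      (forall u c, Eset p q u -> coef p q u c -> c <> 0 -> fdom u) /\
      forall l : list (T * R),
        NoDup (map fst l) ->
        (forall u, In u (map fst l) <->
                   (Eset p q u /\ exists c, coef p q u c /\ c <> 0)) ->
        (forall u c, In (u, c) l -> coef p q u c) ->
        fv p + fv q >=
        fv m + fold_right (fun uc acc => snd uc * fv (fst uc) + acc) 0 l.
End Submodular.

Section LConvex.
Variable V : Type.
Variable ori : V -> V -> Prop.
Variable gdom : V -> Prop.
Variable gv : V -> R.        (* values of g on dom g *)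

(* the neighborhood semilattice I*_x: elements (y,z) stand for [y,z] *)
Definition Istar_carrier (x : V) (e : V * V) : Prop :=
  sqle ori (fst e) (snd e) /\ prec ori (fst e) x /\ prec ori x (snd e).

Definition Istar_le (e1 e2 : V * V) : Prop :=
  forall u, in_interval ori (fst e1) (snd e1) u ->
            in_interval ori (fst e2) (snd e2) u.

Definition gstar_dom (e : V * V) : Prop := gdom (fst e) /\ gdom (snd e).
Definition gstar_val (e : V * V) : R := (gv (fst e) + gv (snd e)) / 2.

Definition L_convex : Prop :=
  delta'_connected ori gdom /\
  forall x, submodular (Istar_carrier x) Istar_le (x, x) gstar_dom gstar_val.

Definition discrete_image : Prop :=
  exists eps, eps > 0 /\
    forall a b, gdom a -> gdom b -> gv a - eps <= gv b <= gv a + eps -> gv b = gv a.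

Definition is_min_on (A : V -> Prop) (y : V) : Prop :=
  A y /\ gdom y /\ forall z, A z -> gdom z -> gv y <= gv z.

Definition opt (y : V) : Prop := is_min_on (fun _ => True) y.

Definition FI (x : V) (y : V) : Prop := Fset ori x y \/ Iset ori x y.

Definition sda_step (x y : V) : Prop :=
  is_min_on (FI x) y /\ gv x <> gv y.

Definition sda_stop (x : V) : Prop :=
  exists y, is_min_on (FI x) y /\ gv x = gv y.

Definition sda_run (x0 : V) (n : nat) : Prop :=
  exists s : nat -> V, s 0%nat = x0 /\
    forall i, (i < n)%nat -> sda_step (s i) (s (S i)).

Definition sda_terminated (x0 : V) (n : nat) : Prop :=
  exists s : nat -> V, s 0%nat = x0 /\
    (forall i, (i < n)%nat -> sda_step (s i) (s (S i))) /\ sda_stop (s n).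
End LConvex.

(* Main.v *)
(* Since the graph is well-oriented, the neighborhood semilattice of [x] is the product of the
   (reversed) ideal and the filter of [x], so L-convexity makes [g] submodular on the filter and on
   the ideal of every [x] in [dom g]. Up-sets and down-sets generated by geodesically convex sets
   are geodesically convex, and on such sets local minimality of [g] implies global minimality.
   Let [K] be convex and up-closed, let [w] minimize [g] over [K] and let [v] minimize [g] over the
   ideal of [w]. Then [v] minimizes [g] over the down-set of [K]: if [v <= z <= k] with [k] in [K],
   all elements [u] occurring in the submodularity inequality for [w] and [z] lie in [K], so
   [g u >= g w], while [g (w /\ z) >= g v]; hence [g z >= g v], i.e. [v] is a local minimizer on
   the down-set. Starting from the filter or the ideal of [x] and alternating, the [n]-th iterate
   minimizes [g] over a set that contains the Delta-ball of radius [n] around [x]. *)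

(* The delicate point is that local minimality implies global minimality. A path of comparable
   vertices in the domain leads from a local minimizer to a supposedly better vertex. It is first
   pushed into the convex set; then its vertices of maximal value are replaced by detours that
   submodularity supplies. Detours never increase the total graph length, so all paths stay in one
   ball, where local finiteness or discreteness of the image bounds the number of times the maximum
   can drop. To control the terms of the submodularity inequality, directions are written as
   [(1 - t, t)]. The coefficient [C(u;p,q)] is then the length of the interval of those [t] for
   which [u] is optimal, and these intervals tile [0,1]; so the right-hand side is a convex
   combination. The constant 2 arises because the first step is spent on reaching a vertex that is
   minimal on its own filter or ideal, and this vertex may be one Delta-step farther from the
   optimum than [x]. *)
From Stdlib Require Import Reals Lra Lia List Relations Arith Classical ClassicalEpsilon.
Require Import Defs.
Open Scope R_scope.
Set Implicit Arguments.
Unset Strict Implicit.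

(** * Geodesics in oriented modular graphs *)

Section WalkFacts.
Variable T : Type.
Variable E : T -> T -> Prop.

Lemma walk_app a b c n m : walk E a b n -> walk E b c m -> walk E a c (n + m).
Proof. induction 1; simpl; eauto using walk_cons. Qed.

Lemma walk_rev a b n : (forall u v, E u v -> E v u) -> walk E a b n -> walk E b a n.
Proof.
intros sym; induction 1; [constructor|].
replace (S n) with (n + 1)%nat by lia.
eapply walk_app; [eassumption|]. eapply walk_cons; [eauto|constructor].
Qed.

Lemma walk_dist a b n : walk E a b n -> exists k, (k <= n)%nat /\ dist E a b k.
Proof.
induction n as [n IH] using (well_founded_induction lt_wf); intros w.
destruct (classic (exists m, (m < n)%nat /\ walk E a b m)) as [[m [lt wm]]|none].
- destruct (IH m lt wm) as [k [le dk]]. exists k; split; [lia|assumption].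
- exists n; split; [lia|split; [assumption|]]. intros m wm.
  destruct (Nat.le_gt_cases n m); [assumption|]. exfalso; eauto.
Qed.
End WalkFacts.

(** A function in place of the relation [dist], so that distances can be handed to [lia]; in a
    connected graph the default value is never taken. *)
Definition gdist V (adj : V -> V -> Prop) (a b : V) : nat :=
  epsilon (inhabits 0%nat) (dist adj a b).

Definition btw V (adj : V -> V -> Prop) (a b z : V) : Prop :=
  (gdist adj a z + gdist adj z b = gdist adj a b)%nat.

Definition convex V (adj : V -> V -> Prop) (C : V -> Prop) : Prop :=
  forall a b z, C a -> C b -> btw adj a b z -> C z.

Definition flip V (ori : V -> V -> Prop) (a b : V) : Prop := ori b a.

Section Metric.
Variable V : Type.
Variables adj ori : V -> V -> Prop.
Hypothesis omg : oriented_modular_graph adj ori.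
Open Scope nat_scope.

Local Notation d := (gdist adj).
Local Notation btw := (btw adj).
Local Notation le := (prec ori).

Lemma adj_sym a b : adj a b -> adj b a.
Proof. apply omg. Qed.

Lemma adj_irrefl a : ~ adj a a.
Proof. apply omg. Qed.

Lemma gdist_spec a b : dist adj a b (d a b).
Proof.
unfold gdist; apply epsilon_spec.
destruct omg as [_ [conn _]]. destruct (conn a b) as [n w].
destruct (walk_dist w) as [k [_ h]]; eauto.
Qed.

Lemma gdist_walk a b n : walk adj a b n -> d a b <= n.
Proof. intros w; apply (gdist_spec a b); assumption. Qed.

Lemma gdist_min_walk a b : walk adj a b (d a b).
Proof. apply gdist_spec. Qed.

Lemma dist_gdist a b n : dist adj a b n <-> n = d a b.
Proof.
split.
- intros [w min]. apply Nat.le_antisymm; [apply min, gdist_min_walk|apply gdist_walk, w].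
- intros ->; apply gdist_spec.
Qed.

Lemma metric_interval_btw a b z : metric_interval adj a b z <-> btw a b z.
Proof.
split.
- intros [n1 [n2 [h1 [h2 h3]]]]. apply dist_gdist in h1, h2, h3. red. lia.
- intros h. exists (d a z), (d z b). rewrite !dist_gdist. auto.
Qed.

Lemma gdist_refl a : d a a = 0.
Proof. assert (h := gdist_walk (walk_nil adj a)). lia. Qed.

Lemma gdist_eq0 a b : d a b = 0 -> a = b.
Proof. intros h. assert (w := gdist_min_walk a b). rewrite h in w. inversion w; auto. Qed.

Lemma gdist_sym a b : d a b = d b a.
Proof.
apply Nat.le_antisymm; apply gdist_walk, walk_rev; auto using adj_sym, gdist_min_walk.
Qed.

Lemma gdist_tri a b c : d a c <= d a b + d b c.
Proof. apply gdist_walk; eapply walk_app; apply gdist_min_walk. Qed.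

Lemma gdist_adj a b : adj a b -> d a b = 1.
Proof.
intros h. assert (h1 : d a b <= 1).
{ apply gdist_walk. eapply walk_cons; [eassumption|constructor]. }
assert (h0 : d a b <> 0).
{ intros h0. apply gdist_eq0 in h0; subst. eapply adj_irrefl; eauto. }
lia.
Qed.

Lemma gdist_adj_inv a b : d a b = 1 -> adj a b.
Proof.
intros h. assert (w := gdist_min_walk a b). rewrite h in w.
inversion w as [|? ? ? ? e w']; subst. inversion w'; subst; assumption.
Qed.

Lemma gdist_toward a b n : d a b = S n -> exists c, adj a c /\ d c b = n.
Proof.
intros h. assert (w := gdist_min_walk a b). rewrite h in w.
inversion w as [|? c ? ? e w']; subst. exists c; split; [assumption|].
apply gdist_walk in w'. assert (h1 := gdist_tri a c b). rewrite (gdist_adj e) in h1. lia.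
Qed.

Lemma median a b c : exists w, btw a b w /\ btw b c w /\ btw c a w.
Proof.
destruct omg as [_ [_ [m _]]]. destruct (m a b c) as [w h].
rewrite !metric_interval_btw in h. eauto.
Qed.

Lemma btw_sym a b z : btw a b z -> btw b a z.
Proof.
red. intros h; red in h. rewrite (gdist_sym b z), (gdist_sym z a), (gdist_sym b a). lia.
Qed.

(** Modular graphs are bipartite: the median of [a], [b], [c] lies on the edge [ab], so it is one of
    its ends. *)
Lemma gdist_parity a b c : adj a b -> d a c = S (d b c) \/ d b c = S (d a c).
Proof.
intros h. destruct (median a b c) as [w [h1 [h2 h3]]]. red in h1, h2, h3.
rewrite (gdist_adj h) in h1. rewrite (gdist_sym c w), (gdist_sym c a), (gdist_sym w a) in h3.
rewrite (gdist_sym b w) in h2.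
lia.
Qed.

(** The two distances to [c] agree, so the median of [a], [b], [c] is equally far from [a] and [b];
    as these are at distance at most two, it is adjacent to both. *)
Lemma quadrangle a b v c : adj v a -> adj v b -> a <> b ->
  d v c = S (d a c) -> d v c = S (d b c) ->
  exists w, adj a w /\ adj w b /\ d a c = S (d w c).
Proof.
intros ha hb ne h1 h2. destruct (median a b c) as [w [m1 [m2 m3]]]. red in m1, m2, m3.
assert (dab : d a b <= 2).
{ assert (t := gdist_tri a v b). rewrite (gdist_sym a v), (gdist_adj ha), (gdist_adj hb) in t. lia. }
assert (d a b <> 0) by (intros e; apply gdist_eq0 in e; auto).
rewrite (gdist_sym c w), (gdist_sym c a), (gdist_sym w a) in m3.
rewrite (gdist_sym b w) in m2.
exists w. assert (d a w = 1 /\ d w b = 1) as [x y] by lia.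
split; [|split]; try (apply gdist_adj_inv; assumption). lia.
Qed.

Lemma prec_refl a : le a a.
Proof. apply rt_refl. Qed.

Lemma prec_trans a b c : le a b -> le b c -> le a c.
Proof. intros h1 h2. eapply rt_trans; eassumption. Qed.

Lemma prec_ori a b : ori b a -> le a b.
Proof. intros h; apply rt_step; exact h. Qed.

Lemma ori_adj a b : ori a b -> adj a b.
Proof. apply omg. Qed.

Lemma adj_ori a b : adj a b -> ori a b \/ ori b a.
Proof. apply omg. Qed.

Lemma ori_asym a b : ori a b -> ori b a -> False.
Proof. intros h1 h2. destruct omg as [_ [_ [_ [[_ [_ h]] _]]]]. eapply h; eauto. Qed.

Lemma ori_parallel x1 x2 x3 x4 : x1 <> x3 -> x2 <> x4 ->
  adj x1 x2 -> adj x2 x3 -> adj x3 x4 -> adj x4 x1 -> ori x1 x2 -> ori x4 x3.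
Proof.
intros n1 n2 h1 h2 h3 h4 o. destruct omg as [_ [_ [_ [_ h]]]].
apply (h x1 x2 x3 x4); [|assumption]. split; [|auto].
assert (nn : forall a b, adj a b -> a <> b) by (intros a b e ->; eapply adj_irrefl; eauto).
repeat constructor; simpl; intuition; subst; eauto using adj_irrefl.
Qed.

(** Walks along [flip ori] climb in the order. The two claims need a joint induction: the second
    one, for the tail, excludes that [p] is closer to [q] than the next vertex [a]; then quadrangles
    and admissibility carry the orientation over to every other neighbour of [p] in the direction of
    [q]. *)
Lemma directed_walk_geodesic p q n : walk (flip ori) p q n ->
  d p q = n /\ forall w, adj p w -> d p q = S (d w q) -> ori w p /\ le w q.
Proof.
induction 1 as [p|p a q n o w IH].
- split; [apply gdist_refl|]. intros w _ h. rewrite gdist_refl in h; lia.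
- destruct IH as [da IH]. red in o.
  assert (ap : adj a p) by (apply ori_adj, o).
  assert (aq : le a q).
  { clear - w. induction w; [apply rt_refl|]. eapply rt_trans; [eassumption|apply rt_step; assumption]. }
  destruct (gdist_parity q ap) as [e|e].
  { exfalso. destruct (IH p ap e) as [o' _]. eapply ori_asym; eauto. }
  split; [lia|]. intros v pv dv.
  destruct (classic (v = a)) as [->|ne]; [auto|].
  assert (ne' : a <> v) by auto.
  destruct (@quadrangle a v p q (adj_sym ap) pv ne' e dv) as [u [au [uv du]]].
  destruct (IH u au du) as [oua leu].
  assert (nup : u <> p).
  { intros ->. eapply ori_asym; eauto. }
  assert (ovp : ori v p).
  { apply (@ori_parallel u a p v); auto using adj_sym. }
  split; [assumption|].
  eapply prec_trans; [|exact leu]. apply prec_ori.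
  apply (@ori_parallel a p v u); auto using adj_sym.
Qed.

Lemma prec_walk p q : le p q -> exists n, walk (flip ori) p q n.
Proof.
intros h. apply clos_rt_rt1n in h. induction h as [x|x y z o h [n w]].
- exists 0; constructor.
- exists (n + 1). eapply walk_app; [exact w|]. eapply walk_cons; [exact o|constructor].
Qed.

Lemma prec_toward p q w : le p q -> adj p w -> d p q = S (d w q) -> ori w p /\ le w q.
Proof. intros h. destruct (prec_walk h) as [n wk]. apply (directed_walk_geodesic wk). Qed.

(** A closed directed walk is geodesic, hence has length 0. *)
Lemma prec_antisym p q : le p q -> le q p -> p = q.
Proof.
intros h1 h2. destruct (prec_walk h1) as [n1 w1]. destruct (prec_walk h2) as [n2 w2].
assert (h := directed_walk_geodesic (walk_app w1 w2)).
destruct h as [h _]. rewrite gdist_refl in h. assert (n1 = 0) by lia. subst n1.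
inversion w1; reflexivity.
Qed.

(** By [prec_toward] every step of a geodesic from [p] to [q] climbs. With [prec_btw], geodesic
    intervals between comparable vertices are order intervals. *)
Lemma btw_prec p q u : le p q -> btw p q u -> le p u /\ le u q.
Proof.
intros h b. red in b. remember (d p u) as n eqn:hn. revert p h b hn.
induction n as [|n IH]; intros p h b hn.
- symmetry in hn; apply gdist_eq0 in hn; subst; split; [apply prec_refl|assumption].
- symmetry in hn. destruct (gdist_toward hn) as [c [pc cu]].
  assert (t1 := gdist_tri c u q). assert (t2 := gdist_tri p c q).
  rewrite (gdist_adj pc) in t2.
  destruct (prec_toward h pc) as [o lec]; [lia|].
  destruct (IH c lec) as [l1 l2]; [lia|lia|].
  split; [|assumption]. eapply prec_trans; [apply prec_ori, o|exact l1].
Qed.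

Lemma prec_btw p q u : le p u -> le u q -> btw p q u.
Proof.
intros h1 h2. destruct (prec_walk h1) as [n1 w1]. destruct (prec_walk h2) as [n2 w2].
red. rewrite (proj1 (directed_walk_geodesic w1)), (proj1 (directed_walk_geodesic w2)).
symmetry; apply (directed_walk_geodesic (walk_app w1 w2)).
Qed.

Lemma btw_refl_l a b : btw a b a.
Proof. red. rewrite gdist_refl. lia. Qed.

Lemma btw_refl_r a b : btw a b b.
Proof. red. rewrite gdist_refl. lia. Qed.

(** * A local criterion for convexity in modular graphs *)

Section LocallyConvex.
Variable C : V -> Prop.
Definition inside (a b : V) : Prop := C a /\ C b /\ adj a b.
Hypothesis conn : forall a b, C a -> C b -> exists n, walk inside a b n.
Hypothesis loc : forall a b z, C a -> C b -> a <> b -> adj a z -> adj z b -> C z.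

Lemma walk_inside_gdist a b n : walk inside a b n -> d a b <= n.
Proof.
intros w. apply gdist_walk. induction w as [|a b c n e w IH]; [constructor|].
eapply walk_cons; [apply e|exact IH].
Qed.

Lemma geodesic_inside a b : (forall z, btw a b z -> C z) -> walk inside a b (d a b).
Proof.
remember (d a b) as n eqn:hn. revert a hn. induction n as [|n IH]; intros a hn h.
- symmetry in hn. apply gdist_eq0 in hn; subst; constructor.
- symmetry in hn. destruct (gdist_toward hn) as [c [ac cb]].
  apply walk_cons with c.
  + split; [|split]; auto; apply h; red; rewrite ?gdist_refl, ?(gdist_adj ac); lia.
  + apply IH; [auto|]. intros z bz. apply h. red in bz |- *.
    assert (t1 := gdist_tri a c z). assert (t2 := gdist_tri a z b).
    rewrite (gdist_adj ac) in t1. lia.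
Qed.

(** Induction on the distance inside [C]: the geodesic interval from the second vertex [s] of a
    shortest inner walk lies in [C], and the quadrangle condition transfers this to every other
    neighbour of [a] in the direction of [b]. *)
Lemma dist_inside_convex n : forall a b, C a -> C b -> dist inside a b n ->
  d a b = n /\ forall z, btw a b z -> C z.
Proof.
induction n as [n IH] using (well_founded_induction lt_wf).
intros a b sa sb [w min].
destruct n as [|n].
{ inversion w; subst. split; [apply gdist_refl|]. intros z bz. red in bz.
  rewrite gdist_refl in bz. assert (e : d b z = 0) by lia. apply gdist_eq0 in e; subst; assumption. }
inversion w as [|? s ? ? e w']; subst. destruct e as [_ [ss as_]].
assert (ds : dist inside s b n).
{ split; [assumption|]. intros m wm. assert (S n <= S m); [|lia].
  apply min. eapply walk_cons; [|exact wm]. repeat split; assumption. }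
destruct (IH n (Nat.lt_succ_diag_r n) s b ss sb ds) as [dsb conv].
assert (dab : d a b = S n).
{ destruct (gdist_parity b as_) as [h|h]; [lia|].
  (* Otherwise [a] lies on a geodesic from [s] to [b], so the induction hypothesis puts a geodesic
     from [a] to [b] inside [C], shorter than the minimal inner walk. *)
  exfalso.
  assert (a <> b). { intros ->. assert (S n <= 0); [apply min; constructor|lia]. }
  assert (st : d s b = S (pred n)) by lia.
  assert (sa' : C a).  { assumption. }
  assert (k : walk inside a b (d a b)).
  { apply geodesic_inside. intros z bz. apply conv. red in bz |- *.
    assert (t1 := gdist_tri s a z). assert (t2 := gdist_tri s z b).
    rewrite (gdist_adj (adj_sym as_)) in t1. lia. }
  apply min in k. lia. }
split; [exact dab|].
(* [v] is adjacent to [a] and to a vertex [u] of the geodesic interval from [s] to [b], both in [C],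
   so [loc] applies. *)
assert (nb : forall v, adj a v -> d v b = n -> C v).
{ intros v av dv. destruct (classic (v = s)) as [->|ne]; [assumption|].
  destruct (@quadrangle v s a b av as_ ne) as [u [vu [us du]]]; [lia|lia|].
  assert (su : C u).
  { apply conv. red. rewrite (gdist_adj (adj_sym us)). lia. }
  apply (@loc a u v sa su); auto using adj_sym.
  intros ->. lia. }
intros z bz. red in bz.
destruct (d a z) as [|k] eqn:dz.
{ apply gdist_eq0 in dz; subst; assumption. }
destruct (gdist_toward dz) as [v [av vz]].
assert (t1 := gdist_tri a v b). assert (t2 := gdist_tri v z b). rewrite (gdist_adj av) in t1.
assert (dv : d v b = n) by lia.
assert (sv := nb v av dv).
(* An inner walk from [v] through [u] makes the induction hypothesis available at [v]. *)
assert (dvS : dist inside v b n).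
{ destruct (classic (v = s)) as [->|ne]; [exact ds|].
  destruct (@quadrangle v s a b av as_ ne) as [u [vu [us du]]]; [lia|lia|].
  split.
  - replace n with (1 + d u b) by lia. eapply walk_app.
    + assert (su : C u). { apply conv. red. rewrite (gdist_adj (adj_sym us)). lia. }
      eapply walk_cons; [|constructor]. repeat split; eassumption.
    + apply geodesic_inside. intros y by_. apply conv. red in by_ |- *.
      assert (t3 := gdist_tri s u y). assert (t4 := gdist_tri s y b).
      rewrite (gdist_adj (adj_sym us)) in t3. lia.
  - intros m wm. apply walk_inside_gdist in wm. lia. }
destruct (IH n (Nat.lt_succ_diag_r n) v b sv sb dvS) as [_ cv].
apply cv. red. lia.
Qed.

Lemma locally_convex_convex : convex adj C.
Proof.
intros a b z sa sb bz. destruct (conn sa sb) as [n w].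
destruct (walk_dist w) as [k [_ dk]].
exact (proj2 (dist_inside_convex sa sb dk) z bz).
Qed.
End LocallyConvex.
End Metric.

(** * Convex sets, meets and joins *)

Lemma prec_flip V (ori : V -> V -> Prop) p q : prec (flip ori) p q <-> prec ori q p.
Proof.
unfold prec; split; induction 1; eauto using rt_step, rt_refl, rt_trans.
Qed.

(** Duality: every result on filters, meets and up-sets, applied to [flip ori], gives the one on
    ideals, joins and down-sets. *)
Lemma omg_flip V (adj ori : V -> V -> Prop) :
  oriented_modular_graph adj ori -> oriented_modular_graph adj (flip ori).
Proof.
intros [sg [cn [md [[o1 [o2 o3]] ad]]]].
split; [|split; [|split; [|split]]]; auto.
- split; [|split]; unfold flip.
  + intros a b h; apply sg; auto.
  + intros a b h; destruct (o2 a b h); auto.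
  + intros a b h; apply (o3 a b); tauto.
- intros x1 x2 x3 x4 [nd [h1 [h2 [h3 h4]]]] o. red in o |- *.
  apply (ad x2 x1 x4 x3); [|exact o]. split.
  + repeat match goal with h : NoDup _ |- _ => inversion h; subst; clear h end.
    simpl in *. repeat constructor; simpl; intuition.
  + destruct sg; auto.
Qed.

Section Lattice.
Variable V : Type.
Variables adj ori : V -> V -> Prop.

Definition is_glb (p q m : V) : Prop :=
  prec ori m p /\ prec ori m q /\ forall t, prec ori t p -> prec ori t q -> prec ori t m.

Definition upset (C : V -> Prop) (y : V) : Prop := exists c, C c /\ prec ori c y.

Definition up_closed (C : V -> Prop) : Prop := forall a b, C a -> prec ori a b -> C b.
End Lattice.

Lemma glb_l V (ori : V -> V -> Prop) p q m : is_glb ori p q m -> prec ori m p.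
Proof. intros h; apply h. Qed.

Lemma glb_r V (ori : V -> V -> Prop) p q m : is_glb ori p q m -> prec ori m q.
Proof. intros h; apply h. Qed.

Lemma glb_greatest V (ori : V -> V -> Prop) p q m t :
  is_glb ori p q m -> prec ori t p -> prec ori t q -> prec ori t m.
Proof. intros h; apply h. Qed.

Section IdealConvex.
Variable V : Type.
Variables adj ori : V -> V -> Prop.
Hypothesis omg : oriented_modular_graph adj ori.
Open Scope nat_scope.

Local Notation d := (gdist adj).
Local Notation btw := (btw adj).
Local Notation le := (prec ori).

Lemma prec_inside (C : V -> Prop) p q n : up_closed ori C -> C p ->
  walk (flip ori) p q n -> walk (inside adj C) p q n.
Proof.
intros uc cp w. induction w as [|a b c n o w IH]; [constructor|].
assert (cb : C b) by (eapply uc; [exact cp|apply rt_step; exact o]).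
eapply walk_cons; [|apply IH, cb].
split; [|split]; auto. apply (adj_sym omg), (ori_adj omg), o.
Qed.

Lemma inside_sym (C : V -> Prop) a b : inside adj C a b -> inside adj C b a.
Proof. intros [? [? ?]]; repeat split; auto. apply (adj_sym omg); assumption. Qed.

Lemma filter_convex p : convex adj (le p).
Proof.
apply (locally_convex_convex omg).
- intros a b pa pb. destruct (prec_walk pa) as [n wn], (prec_walk pb) as [m wm].
  exists (n + m). eapply walk_app.
  + apply walk_rev; [apply inside_sym|]. eapply prec_inside; [|apply prec_refl|exact wn].
    intros x y; apply prec_trans.
  + eapply prec_inside; [|apply prec_refl|exact wm]. intros x y; apply prec_trans.
- intros a b z pa pb ne az zb.
  destruct (adj_ori omg az) as [oaz|oza].
  2:{ eapply prec_trans; [exact pa|apply prec_ori, oza]. }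
  destruct (adj_ori omg zb) as [ozb|obz].
  { eapply prec_trans; [exact pb|apply prec_ori, ozb]. }
  assert (omg' := omg_flip omg).
  assert (toward : forall x w, le p x -> adj x w -> d x p = S (d w p) -> ori x w /\ le p w).
  { intros x w px xw h. apply prec_flip in px.
    destruct (prec_toward omg' px xw h) as [o l]. apply prec_flip in l. split; assumption. }
  destruct (gdist_parity omg p az) as [e|e].
  { apply (toward a z); assumption. }
  destruct (gdist_parity omg p zb) as [e'|e'].
  2:{ apply (toward b z); [assumption|apply (adj_sym omg); assumption|assumption]. }
  (* A common neighbour [z] below [a] and [b] but farther from [p] would come with a second vertex
     [w] covered by both; admissibility on the 4-cycle [a], [z], [b], [w] forbids this. *)
  destruct (@quadrangle V adj ori omg a b z p (adj_sym omg az) zb ne e e') as [w [aw [wb dw]]].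
  destruct (toward a w pa aw dw) as [oaw pw].
  destruct (toward b w pb (adj_sym omg wb)) as [obw _]; [lia|].
  exfalso. assert (z <> w) by (intros ->; lia).
  apply (ori_asym omg obw).
  apply (@ori_parallel V adj ori omg a z b w); auto; apply (adj_sym omg); assumption.
Qed.
End IdealConvex.

Section Meets.
Variable V : Type.
Variables adj ori : V -> V -> Prop.
Hypothesis omg : oriented_modular_graph adj ori.
Open Scope nat_scope.

Local Notation d := (gdist adj).
Local Notation btw := (btw adj).
Local Notation le := (prec ori).

Lemma ideal_convex p : convex adj (fun y => le y p).
Proof.
intros a b z ha hb h. apply prec_flip.
apply (filter_convex (omg_flip omg) (p := p)) with a b; rewrite ?prec_flip; assumption.
Qed.

Lemma btw_ideal a b p z : le a p -> le b p -> btw a b z -> le z p.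
Proof. apply (ideal_convex (p := p)). Qed.

Lemma btw_filter a b p z : le p a -> le p b -> btw a b z -> le p z.
Proof. apply (filter_convex omg). Qed.

(** The median of [m], [n] and [p] is a common lower bound of [p] and [q] above both [m] and [n],
    and a lower bound on a geodesic never lies strictly below another common lower bound. *)
Lemma lower_bound_btw_unique p q m n : le m p -> le m q -> btw p q m ->
  le n p -> le n q -> btw p q n -> m = n.
Proof.
intros mp mq bm np nq bn.
destruct (median omg m n p) as [s [h1 [h2 h3]]].
assert (sq : le s q) by (apply (btw_ideal mq nq h1)).
apply (btw_sym omg) in h3.
apply (btw_prec omg mp) in h3. apply (btw_prec omg np) in h2.
destruct h2 as [ns sp], h3 as [ms _].
assert (e : forall t, le t s -> btw p q t -> t = s).
{ intros t ts bt. apply (gdist_eq0 omg).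
  assert (x1 := prec_btw omg ts sp). assert (x2 := prec_btw omg ts sq).
  red in x1, x2, bt. rewrite (gdist_sym omg p t) in bt.
  assert (x3 := gdist_tri omg p s q). rewrite (gdist_sym omg p s) in x3. lia. }
rewrite (e m), (e n); auto.
Qed.

(** Any common lower bound [t] lies below the median of [p], [q], [t], which is itself a lower bound
    on a geodesic and so equals [m]. *)
Lemma btw_lower_bound_glb p q m : le m p -> le m q -> btw p q m -> is_glb ori p q m.
Proof.
intros mp mq bm. split; [|split]; auto. intros t tp tq.
destruct (median omg p q t) as [n [h1 [h2 h3]]].
apply (btw_sym omg) in h2.
apply (btw_prec omg tq) in h2. apply (btw_prec omg tp) in h3.
rewrite (@lower_bound_btw_unique p q m n); tauto.
Qed.

Lemma glb_exists p q z : le z p -> le z q -> exists m, is_glb ori p q m /\ btw p q m /\ le z m.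
Proof.
intros zp zq. destruct (median omg p q z) as [m [h1 [h2 h3]]].
apply (btw_sym omg) in h2.
apply (btw_prec omg zq) in h2. apply (btw_prec omg zp) in h3.
exists m; split; [|tauto]. apply btw_lower_bound_glb; tauto.
Qed.

Lemma glb_unique p q m n : is_glb ori p q m -> is_glb ori p q n -> m = n.
Proof.
intros [a1 [a2 a3]] [b1 [b2 b3]]. apply (prec_antisym omg); auto.
Qed.

Lemma glb_btw p q m : is_glb ori p q m -> btw p q m.
Proof.
intros h. destruct h as [h1 [h2 h3]] eqn:e.
destruct (glb_exists h1 h2) as [n [g [b _]]]. rewrite (glb_unique h g). exact b.
Qed.

(** The median of the three upper bounds works, since filters are convex. This is the semilattice
    axiom on pairwise joinable triples. *)
Lemma triple_bounded a b c x y w : le a x -> le b x -> le b y -> le c y -> le c w -> le a w ->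
  exists t, le a t /\ le b t /\ le c t.
Proof.
intros. destruct (median omg x y w) as [t [h1 [h2 h3]]].
exists t; split; [|split].
- apply (@btw_filter w x); assumption.
- apply (@btw_filter x y); assumption.
- apply (@btw_filter y w); assumption.
Qed.

Lemma convex_upset C : convex adj C -> convex adj (upset ori C).
Proof.
intros cv. apply (locally_convex_convex omg).
- intros a b [c [cc ca]] [c' [cc' cb]].
  destruct (prec_walk ca) as [n wn], (prec_walk cb) as [m wm].
  assert (uc : up_closed ori (upset ori C)).
  { intros x y [e [ce ex]] xy. exists e; split; [assumption|]. eapply prec_trans; eassumption. }
  assert (sub : forall x, C x -> upset ori C x) by (intros x cx; exists x; split; [auto|apply prec_refl]).
  exists (n + (d c c' + m)). eapply walk_app; [|eapply walk_app].
  + apply walk_rev; [apply (inside_sym omg)|]. apply (prec_inside omg uc); [apply sub, cc|exact wn].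
  + apply (geodesic_inside omg). intros z bz. apply sub, (cv c c'); assumption.
  + apply (prec_inside omg uc); [apply sub, cc'|exact wm].
- intros a b z [c [cc ca]] [c' [cc' cb]] ne az zb.
  destruct (adj_ori omg az) as [oaz|oza].
  2:{ exists c; split; [assumption|]. eapply prec_trans; [exact ca|apply prec_ori, oza]. }
  destruct (adj_ori omg zb) as [ozb|obz].
  { exists c'; split; [assumption|]. eapply prec_trans; [exact cb|apply prec_ori, ozb]. }
  assert (za : le z a) by (apply prec_ori; assumption).
  assert (zb' : le z b) by (apply prec_ori; assumption).
  (* Here [z] is the meet of [a] and [b], so an element of [C] below both of them is below [z]; the
     convexity of ideals shows that the median is one. *)
  destruct (median omg c c' z) as [m [h1 [h2 h3]]].
  exists m; split; [apply (cv c c'); assumption|].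
  assert (bz : btw a b z).
  { red. rewrite (gdist_adj omg az), (gdist_adj omg zb).
    assert (d a b <> 0) by (intros e; apply (gdist_eq0 omg) in e; auto).
    assert (t := gdist_tri omg a z b). rewrite (gdist_adj omg az), (gdist_adj omg zb) in t.
    assert (t' := gdist_parity omg b az). rewrite (gdist_adj omg zb) in t'. lia. }
  apply (btw_lower_bound_glb za zb' bz).
  + apply (btw_ideal za ca h3).
  + apply (btw_ideal cb zb' h2).
Qed.

End Meets.

Section Joins.
Variable V : Type.
Variables adj ori : V -> V -> Prop.
Hypothesis omg : oriented_modular_graph adj ori.
Open Scope nat_scope.

Local Notation d := (gdist adj).
Local Notation btw := (btw adj).
Local Notation le := (prec ori).

(* [a] and [a1] both complement [b] in the interval from [m] to [j], hence have the same rank. *)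
Lemma glb_lub_cancel p q m a b j a1 : is_glb ori p q m -> le m a -> le a p -> le m b -> le b q ->
  is_glb (flip ori) a b j -> le a a1 -> le a1 p -> le a1 j -> a1 = a.
Proof.
intros g ma ap mb bq [ja [jb jl]] aa1 a1p a1j.
rewrite prec_flip in ja, jb.
assert (mglb : forall x, le m x -> le x p -> is_glb ori x b m).
{ intros x mx xp. split; [|split]; auto. intros t tx tb. apply (proj2 (proj2 g)); [exact (prec_trans tx xp)|exact (prec_trans tb bq)]. }
assert (jlub : forall x, le a x -> le x j -> is_glb (flip ori) x b j).
{ intros x ax xj. split; [|split]; rewrite ?prec_flip; auto. intros t tx tb. apply jl; auto.
  rewrite prec_flip in *. exact (prec_trans ax tx). }
assert (x1 := glb_btw omg (mglb a ma ap)).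
assert (x2 := glb_btw omg (mglb a1 (prec_trans ma aa1) a1p)).
assert (lub_btw := glb_btw (omg_flip omg)).
assert (x3 := lub_btw _ _ _ (jlub a (prec_refl ori a) ja)).
assert (x4 := lub_btw _ _ _ (jlub a1 aa1 a1j)).
assert (x5 := prec_btw omg ma aa1). assert (x6 := prec_btw omg aa1 a1j).
red in x1, x2, x3, x4, x5, x6.
rewrite (gdist_sym omg a m) in x1. rewrite (gdist_sym omg a1 m) in x2.
symmetry; apply (gdist_eq0 omg). lia.
Qed.
End Joins.

(** * Geodesic intervals between two elements of a filter *)

Section Intervals.
Variable V : Type.
Variables adj ori : V -> V -> Prop.
Hypothesis omg : oriented_modular_graph adj ori.
Open Scope nat_scope.

Local Notation d := (gdist adj).
Local Notation btw := (btw adj).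
Local Notation le := (prec ori).
Definition is_lub (p q j : V) : Prop :=
  le p j /\ le q j /\ forall t, le p t -> le q t -> le j t.

Lemma lub_l p q j : is_lub p q j -> le p j.
Proof. intros h; apply h. Qed.

Lemma lub_r p q j : is_lub p q j -> le q j.
Proof. intros h; apply h. Qed.

Lemma lub_least p q j t : is_lub p q j -> le p t -> le q t -> le j t.
Proof. intros h; apply h. Qed.

Lemma is_lub_flip p q j : is_glb (flip ori) p q j <-> is_lub p q j.
Proof.
unfold is_glb, is_lub. rewrite !prec_flip.
split; intros [h1 [h2 h3]]; repeat split; auto; intros t; [|rewrite !prec_flip]; auto.
intros t1 t2. apply prec_flip, h3; apply prec_flip; assumption.
Qed.

Lemma lub_exists p q z : le p z -> le q z -> exists j, is_lub p q j /\ btw p q j /\ le j z.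
Proof.
intros h1 h2. apply prec_flip in h1, h2.
destruct (glb_exists (omg_flip omg) h1 h2) as [j h]. rewrite is_lub_flip, prec_flip in h.
exists j; exact h.
Qed.

Lemma lub_btw p q j : is_lub p q j -> btw p q j.
Proof. intros h. apply is_lub_flip in h. apply (glb_btw (omg_flip omg) h). Qed.

Lemma btw_upper_bound_lub p q j : le p j -> le q j -> btw p q j -> is_lub p q j.
Proof.
intros h1 h2 h3. apply is_lub_flip. apply prec_flip in h1, h2.
exact (btw_lower_bound_glb (omg_flip omg) h1 h2 h3).
Qed.

Lemma glb_sym p q m : is_glb ori p q m -> is_glb ori q p m.
Proof. intros [h1 [h2 h3]]; repeat split; auto. Qed.

Lemma lub_sym p q m : is_lub p q m -> is_lub q p m.
Proof. intros [h1 [h2 h3]]; repeat split; auto. Qed.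

Lemma glb_le p q : le p q -> is_glb ori p q p.
Proof. intros h; repeat split; auto. apply prec_refl. Qed.

(** The modular rank law, with the distance from [m] as rank: the ways from [a] to [b] through the
    meet and through the join are both geodesic. *)
Lemma glb_lub_rank m a b x y : le m x -> is_glb ori a b x -> is_lub a b y ->
  d m x + d m y = d m a + d m b.
Proof.
intros mx g l. assert (h1 := glb_btw omg g). assert (h2 := lub_btw l).
destruct g as [xa [xb _]], l as [ay [by_ _]].
assert (e1 := prec_btw omg mx xa). assert (e2 := prec_btw omg mx xb).
assert (e3 := prec_btw omg (prec_trans mx xa) ay).
assert (e4 := prec_btw omg (prec_trans mx xb) by_).
red in h1, h2, e1, e2, e3, e4.
rewrite (gdist_sym omg a x) in h1. rewrite (gdist_sym omg y b) in h2. lia.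
Qed.

Lemma prec_rank_eq m a b : le m a -> le a b -> d m a = d m b -> a = b.
Proof.
intros h1 h2 e. assert (h := prec_btw omg h1 h2). red in h. apply (gdist_eq0 omg). lia.
Qed.

Lemma prec_rank_le m a b : le m a -> le a b -> d m a <= d m b.
Proof. intros h1 h2. assert (h := prec_btw omg h1 h2). red in h. lia. Qed.

Section Pair.
Variables p q m : V.
Hypothesis glb_pq : is_glb ori p q m.

Let mp : le m p := proj1 glb_pq.
Let mq : le m q := proj1 (proj2 glb_pq).

Lemma btw_above u : btw p q u -> le m u.
Proof. apply (btw_filter omg mp mq). Qed.

(** Coordinates of an interval element: the ranks of [a] and [b] above the meet of [p] and [q] are
    the entries of r(u;p,q). *)
Definition parts (u a b : V) : Prop :=
  btw p q u /\ is_glb ori u p a /\ is_glb ori u q b.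

Lemma parts_exist u : btw p q u -> exists a b, parts u a b.
Proof.
intros bu. assert (mu := btw_above bu).
destruct (glb_exists omg mu mp) as [a [ga _]].
destruct (glb_exists omg mu mq) as [b [gb _]].
exists a, b; split; auto.
Qed.

Lemma parts_above u a b : parts u a b -> le m a /\ le m b /\ le a p /\ le b q.
Proof.
intros [bu [[_ [ap ga]] [_ [bq gb]]]]. assert (mu := btw_above bu). auto.
Qed.

(** A geodesic from [p] to [q] passes through [a], [u], [b] in this order, and an upper bound on a
    geodesic is a join. *)
Lemma parts_lub u a b : parts u a b -> is_lub a b u.
Proof.
intros [bu [ga gb]]. assert (ba := glb_btw omg ga). assert (bb := glb_btw omg gb).
destruct ga as [au [ap _]], gb as [bu' [bq _]].
apply btw_upper_bound_lub; auto.
red in bu, ba, bb |- *.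
assert (t1 := gdist_tri omg p a q). assert (t2 := gdist_tri omg a b q).
assert (t3 := gdist_tri omg a u b).
rewrite (gdist_sym omg u p), (gdist_sym omg u a), (gdist_sym omg a p) in ba. lia.
Qed.

(** Converse of [parts_lub]: interval elements correspond to pairs below [p] and [q] that have a
    join. By [glb_lub_cancel], forming the join does not enlarge the coordinates. *)
Lemma lub_parts a b j : le m a -> le a p -> le m b -> le b q -> is_lub a b j -> parts j a b.
Proof.
intros ma ap mb bq l.
assert (mj : le m j) by exact (prec_trans ma (lub_l l)).
destruct (glb_exists omg mj mp) as [a1 [ga [ba _]]].
destruct (glb_exists omg mj mq) as [b1 [gb [bb _]]].
assert (l' := l). apply is_lub_flip in l'.
assert (a1 = a) as ->.
{ apply (@glb_lub_cancel V adj ori omg p q m a b j a1); auto; eauto using glb_l, glb_r, glb_greatest, lub_l. }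
assert (b1 = b) as ->.
{ apply (@glb_lub_cancel V adj ori omg q p m b a j b1); auto; eauto using glb_l, glb_r, glb_greatest, lub_r.
  - apply glb_sym, glb_pq.
  - apply is_lub_flip, lub_sym, l. }
split; [|auto].
assert (x := lub_btw l). assert (y := glb_btw omg glb_pq).
assert (gab : is_glb ori a b m).
{ split; [|split]; auto. intros t ta tb.
  apply (glb_greatest glb_pq); [exact (prec_trans ta ap)|exact (prec_trans tb bq)]. }
assert (z := glb_btw omg gab).
assert (e1 := prec_btw omg ma ap). assert (e2 := prec_btw omg mb bq).
red in x, y, z, e1, e2, ba, bb |- *.
rewrite (gdist_sym omg p j), (gdist_sym omg p q) in *.
rewrite (gdist_sym omg a m), (gdist_sym omg a b) in *.
rewrite (gdist_sym omg p m) in *. rewrite (gdist_sym omg q p) in *.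
rewrite (gdist_sym omg j a), (gdist_sym omg b a) in *. lia.
Qed.

(** The elements [a], [y], [a'] are pairwise bounded, by [u], [u'] and [p], so they have a common
    upper bound and the new pair of coordinates has a join. *)
Lemma parts_exchange u a b u' a' b' : parts u a b -> parts u' a' b' ->
  exists u1 x y, parts u1 x y /\ is_lub a a' x /\ is_glb ori b b' y.
Proof.
intros h h'. destruct (parts_above h) as [ma [mb [ap bq]]].
destruct (parts_above h') as [ma' [mb' [ap' bq']]].
destruct (lub_exists ap ap') as [x [lx [_ xp]]].
destruct (glb_exists omg mb mb') as [y [gy [_ my]]].
assert (lu := parts_lub h). assert (lu' := parts_lub h').
assert (yu : le y u). { exact (prec_trans (glb_l gy) (lub_r lu)). }
assert (yu' : le y u'). { exact (prec_trans (glb_r gy) (lub_r lu')). }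
destruct (@triple_bounded V adj ori omg a y a' u u' p) as [t [t1 [t2 t3]]]; auto.
{ exact (lub_l lu). } { exact (lub_l lu'). }
assert (xt : le x t) by (apply (lub_least lx); auto).
destruct (lub_exists xt t2) as [j [lj _]].
exists j, x, y; split; [|auto]. apply lub_parts; auto.
- exact (prec_trans ma (lub_l lx)).
- exact (prec_trans (glb_l gy) bq).
Qed.

Lemma parts_l : parts p p m.
Proof. split; [apply (btw_refl_l omg)|split; [apply glb_le, prec_refl|exact glb_pq]]. Qed.

Lemma parts_r : parts q m q.
Proof.
split; [apply (btw_refl_r omg)|split; [apply glb_sym, glb_pq|apply glb_le, prec_refl]].
Qed.

End Pair.

Lemma parts_swap p q u a b : parts p q u a b -> parts q p u b a.
Proof. intros [h1 [h2 h3]]; split; [apply (btw_sym omg); assumption|auto]. Qed.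

(** Exchanging in both directions gives two elements whose rank vectors have the given vector as
    midpoint; if these two agreed, then [a = a'] and [b = b']. Hence an extreme rank vector belongs
    to a single element. *)
Lemma equal_rank_parts p q m u a b u' a' b' :
  is_glb ori p q m -> parts p q u a b -> parts p q u' a' b' -> u <> u' ->
  d m a = d m a' -> d m b = d m b' ->
  exists u1 a1 b1 u2 a2 b2, parts p q u1 a1 b1 /\ parts p q u2 a2 b2 /\
    d m a1 + d m a2 = 2 * d m a /\ d m b1 + d m b2 = 2 * d m b /\
    ~ (d m a1 = d m a2 /\ d m b1 = d m b2).
Proof.
intros g h h' ne ea eb.
destruct (parts_exchange g h h') as [u1 [x [y [h1 [lx gy]]]]].
destruct (parts_exchange (glb_sym g) (parts_swap h) (parts_swap h')) as [u2 [z [w [h2 [lz gw]]]]].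
apply parts_swap in h2.
destruct (parts_above g h) as [ma [mb _]]. destruct (parts_above g h') as [ma' [mb' _]].
assert (mw : le m w) by (apply (glb_greatest gw); auto).
assert (my : le m y) by (apply (glb_greatest gy); auto).
assert (r1 := glb_lub_rank mw gw lx). assert (r2 := glb_lub_rank my gy lz).
exists u1, x, y, u2, w, z. repeat (split; [solve [assumption|lia]|]).
intros [e1 e2]. apply ne.
assert (eqs : forall s t lo hi, le m s -> le m t -> le m lo -> is_glb ori s t lo -> is_lub s t hi ->
   d m hi = d m lo -> s = t).
{ intros s t lo hi ms mt ml gl lb e.
  assert (le lo hi) by (exact (prec_trans (glb_l gl) (lub_l lb))).
  assert (lo = hi) by (eapply prec_rank_eq; eauto). subst hi.
  apply (prec_antisym omg).
  - exact (prec_trans (lub_l lb) (glb_r gl)).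
  - exact (prec_trans (lub_r lb) (glb_l gl)). }
assert (a = a') by (apply (eqs a a' w x); auto).
assert (b = b') by (apply (eqs b b' y z); auto).
subst a' b'. assert (l1 := parts_lub h). assert (l2 := parts_lub h').
apply (prec_antisym omg); [apply (lub_least l1)|apply (lub_least l2)];
  eauto using lub_l, lub_r.
Qed.

(** Exchange with [n], whose second coordinate is [q] itself, keeps [b] and replaces [a] by its join
    with [n1]; maximality forces this join to be [a]. *)
Lemma maximal_parts_above p q m u a b n n1 n2 : is_glb ori p q m -> parts p q u a b ->
  (forall u1 a1 b1, parts p q u1 a1 b1 -> d m a <= d m a1 -> d m b <= d m b1 ->
     d m a1 = d m a /\ d m b1 = d m b) ->
  parts p q n n1 n2 -> le q n -> le n1 a.
Proof.
intros g h mx hn qn.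
destruct (parts_exchange g h hn) as [u1 [x [y [h1 [lx gy]]]]].
destruct (parts_above g h) as [ma [mb [_ bq]]].
assert (n2 = q) as ->.
{ destruct hn as [_ [_ [e1 [e2 e3]]]]. apply (prec_antisym omg); [assumption|].
  apply e3; [assumption|apply prec_refl]. }
assert (y = b) as ->.
{ apply (prec_antisym omg); [exact (glb_l gy)|].
  apply (glb_greatest gy); [apply prec_refl|assumption]. }
destruct (mx _ _ _ h1) as [e _].
- apply prec_rank_le; [assumption|exact (lub_l lx)].
- lia.
- replace a with x; [exact (lub_r lx)|]. symmetry. eapply prec_rank_eq; [exact ma|exact (lub_l lx)|auto].
Qed.
End Intervals.

(** * The normal fan of a finite planar point set *)

Definition rsum (A : Type) (f : A -> R) (l : list A) : R :=
  fold_right (fun x acc => f x + acc) 0 l.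

Lemma rsum_app A (f : A -> R) l1 l2 : rsum f (l1 ++ l2) = rsum f l1 + rsum f l2.
Proof. induction l1; simpl; [lra|]. fold (rsum f (l1 ++ l2)) (rsum f l1). lra. Qed.

Lemma rsum_le A (f g : A -> R) l : (forall x, In x l -> f x <= g x) -> rsum f l <= rsum g l.
Proof.
induction l as [|x l IH]; intros h; simpl; [lra|].
fold (rsum f l) (rsum g l). specialize (IH (fun y hy => h y (or_intror hy))).
specialize (h x (or_introl eq_refl)). lra.
Qed.

Lemma rsum_lin A (f g : A -> R) k l : rsum (fun x => f x + k * g x) l = rsum f l + k * rsum g l.
Proof. induction l as [|x l IH]; simpl; [lra|]. fold (rsum f l) (rsum g l) (rsum (fun x => f x + k * g x) l). lra. Qed.

(** * Finite coverings of a real interval by segments *)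

Section IntervalCover.
Variable A : Type.
Local Notation lo e := (fst (snd e)).
Local Notation hi e := (snd (snd e)).

Lemma avoid_finite (F : list R) a b : a < b -> exists t, a < t < b /\ ~ In t F.
Proof.
revert a b. induction F as [|x F IH]; intros a b ab.
- exists ((a + b) / 2); split; [lra|simpl; tauto].
- destruct (IH a b ab) as [t [tab nt]].
  destruct (Req_dec x t) as [e|ne].
  + destruct (IH a t) as [s [sab ns]]; [lra|]. exists s; split; [lra|].
    simpl; intros [h|h]; [lra|auto].
  + exists t; split; [assumption|]. simpl; tauto.
Qed.

(** If all right ends stayed below [b], the gap before [b] would be covered by the finite set [F]
    alone. In the application [F] absorbs the segments of length zero. *)
Lemma cover_hits_right (l : list (A * (R * R))) a b F : a < b ->
  (forall e, In e l -> hi e <= b) ->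
  (forall t, a <= t <= b -> In t F \/ exists e, In e l /\ lo e <= t <= hi e) ->
  exists e, In e l /\ hi e = b.
Proof.
intros ab hb cov. apply NNPP; intros no.
assert (M : exists m, a <= m < b /\ forall e, In e l -> hi e <= m).
{ assert (hb' : forall e, In e l -> hi e < b).
  { intros e he. destruct (hb e he) as [h|h]; [assumption|]. exfalso; eauto. }
  clear - hb' ab. induction l as [|e l IH].
  - exists a; split; [lra|simpl; tauto].
  - destruct IH as [m [mb hm]]; [intros; apply hb'; simpl; auto|].
    assert (h := hb' e (or_introl eq_refl)).
    exists (Rmax m (hi e)). split.
    + split; [eapply Rle_trans; [apply mb|apply Rmax_l]|]. apply Rmax_lub_lt; lra.
    + intros e' [<-|h']; [apply Rmax_r|]. eapply Rle_trans; [apply hm, h'|apply Rmax_l]. }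
destruct M as [m [mb hm]]. destruct (avoid_finite F (proj2 mb)) as [t [tb nt]].
destruct (cov t) as [h|[e [he h]]]; [lra|contradiction|].
specialize (hm e he). lra.
Qed.

Lemma cover_length (l : list (A * (R * R))) : forall a b F, a <= b ->
  NoDup (map fst l) ->
  (forall e, In e l -> a <= lo e /\ lo e < hi e /\ hi e <= b) ->
  (forall e e', In e l -> In e' l -> fst e <> fst e' -> hi e <= lo e' \/ hi e' <= lo e) ->
  (forall t, a <= t <= b -> In t F \/ exists e, In e l /\ lo e <= t <= hi e) ->
  rsum (fun e => hi e - lo e) l = b - a.
Proof.
remember (length l) as n eqn:hn. revert l hn.
induction n as [|n IH]; intros l hn a b F ab nd rg dj cov.
- destruct l; [|discriminate]. simpl.
  destruct ab as [ab|ab]; [|lra]. exfalso.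
  destruct (avoid_finite F ab) as [t [tab nt]].
  destruct (cov t) as [h|[e [[] _]]]; [lra|auto].
- assert (ab' : a < b).
  { destruct l as [|e l]; [discriminate|]. specialize (rg e (or_introl eq_refl)). lra. }
  destruct (@cover_hits_right l a b F ab') as [e [he hb]]; [intros e he; apply rg, he|exact cov|].
  destruct (in_split _ _ he) as [l1 [l2 hl]].
  assert (re := rg e he).
  assert (sub : forall e', In e' (l1 ++ l2) -> In e' l).
  { intros e' h. rewrite hl. apply in_app_iff in h. apply in_app_iff. simpl. tauto. }
  rewrite hl, map_app in nd. simpl in nd.
  assert (ne : forall e', In e' (l1 ++ l2) -> fst e <> fst e').
  { intros e' h eq. apply (NoDup_remove_2 _ _ _ nd). rewrite <- map_app, eq. apply in_map, h. }
  assert (IH' := IH (l1 ++ l2)).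
  assert (len : n = length (l1 ++ l2)).
  { rewrite hl, length_app in hn. simpl in hn. rewrite length_app. lia. }
  (* The segment ending at [b] is removed; its left end may thereby become uncovered, so it joins
     the exceptional points. *)
  specialize (IH' len a (lo e) (lo e :: F)).
  rewrite hl, rsum_app. simpl. fold (rsum (fun e => hi e - lo e) l2).
  rewrite rsum_app in IH'.
  rewrite <- hb. enough (rsum (fun e0 => hi e0 - lo e0) l1 + rsum (fun e0 => hi e0 - lo e0) l2 = lo e - a) by lra.
  apply IH'.
  + lra.
  + rewrite map_app. apply (NoDup_remove_1 _ _ _ nd).
  + intros e' h'. assert (r' := rg e' (sub e' h')). destruct (dj e e' he (sub e' h') (ne e' h')); lra.
  + intros e1 e2 h1 h2. apply dj; auto.
  + intros t ht. destruct (cov t) as [h|[e' [h' r']]]; [lra|left; simpl; auto|].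
    rewrite hl in h'. apply in_app_iff in h'. simpl in h'.
    destruct h' as [h'|[<-|h']].
    * right; exists e'; split; [apply in_app_iff; auto|assumption].
    * left; simpl; lra.
    * right; exists e'; split; [apply in_app_iff; auto|assumption].
Qed.
End IntervalCover.

(** Nonzero weights in the quadrant are scaled to sum 1, so that one real parameter [t] describes
    all directions. *)
Definition val (t : R) (z : R * R) : R := (1 - t) * fst z + t * snd z.

Definition amax (K : R * R -> Prop) (t : R) (z : R * R) : Prop :=
  forall z', K z' -> val t z' <= val t z.

Lemma val_eq_twice t1 t2 z z' : t1 < t2 -> val t1 z = val t1 z' -> val t2 z = val t2 z' -> z = z'.
Proof.
unfold val; destruct z as [x y], z' as [x' y']; simpl. intros lt e1 e2.
assert (h : (t2 - t1) * ((y - y') - (x - x')) = 0) by lra.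
apply Rmult_integral in h. destruct h as [h|h]; [lra|].
assert (y - y' = x - x') by lra.
assert (x = x'). { replace y with (y' + (x - x')) in e1 by lra. lra. }
f_equal; lra.
Qed.

(** Each competitor [z'] restricts [t] by one affine inequality [a + t * b <= 0]. *)
Lemma amax_interval (L : list (R * R)) z :
  (forall t, 0 <= t <= 1 -> ~ amax (fun z' => In z' L) t z) \/
  exists lo hi, 0 <= lo <= hi /\ hi <= 1 /\
    forall t, 0 <= t <= 1 -> (amax (fun z' => In z' L) t z <-> lo <= t <= hi).
Proof.
induction L as [|z' L IH].
- right. exists 0, 1. split; [lra|split; [lra|]]. intros t ht. split; [intros; lra|].
  intros _ z' [].
- assert (spl : forall t, amax (fun y => In y (z' :: L)) t z <->
     amax (fun y => In y L) t z /\ val t z' <= val t z).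
  { intros t; split.
    - intros h; split; [intros y hy|]; apply h; simpl; auto.
    - intros [h1 h2] y [<-|hy]; auto. }
  destruct IH as [no|[lo [hi [h1 [h2 h3]]]]].
  { left. intros t ht h. apply spl in h. apply (no t ht), h. }
  set (a := fst z' - fst z). set (b := snd z' - snd z - a).
  assert (half : forall t, val t z' <= val t z <-> a + t * b <= 0).
  { intros t. unfold val, b, a. split; intros; lra. }
  assert (key : forall t, 0 <= t <= 1 -> (amax (fun y => In y (z' :: L)) t z <-> lo <= t <= hi /\ a + t * b <= 0)).
  { intros t ht. rewrite spl, half, h3; tauto. }
  destruct (Rtotal_order b 0) as [hb|[hb|hb]].
  + assert (cut : forall t, a + t * b <= 0 <-> - a / b <= t).
    { intros t. replace a with (- (- a / b) * b) at 1 by (field; lra). split; intros; nra. }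
    destruct (Rle_dec (Rmax lo (- a / b)) hi) as [h|h].
    * right. exists (Rmax lo (- a / b)), hi. assert (hl := Rmax_l lo (- a / b)).
      split; [lra|split; [lra|]]. intros t ht. rewrite key, cut by assumption.
      split; [intros [x y]; split; [apply Rmax_lub; lra|lra]|].
      intros x. assert (hr := Rmax_r lo (- a / b)). lra.
    * left. intros t ht h'. apply key in h'; [|assumption]. rewrite cut in h'.
      apply h. apply Rmax_lub; lra.
  + rewrite hb in key. destruct (Rle_dec a 0).
    * right. exists lo, hi. split; [lra|split; [lra|]]. intros t ht. rewrite key by assumption.
      split; [tauto|]. intros; split; [assumption|lra].
    * left. intros t ht h'. apply key in h'; [|assumption]. lra.
  + assert (cut : forall t, a + t * b <= 0 <-> t <= - a / b).
    { intros t. replace a with (- (- a / b) * b) at 1 by (field; lra). split; intros; nra. }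
    destruct (Rle_dec lo (Rmin hi (- a / b))) as [h|h].
    * right. exists lo, (Rmin hi (- a / b)). assert (hl := Rmin_l hi (- a / b)).
      split; [lra|split; [lra|]]. intros t ht. rewrite key, cut by assumption.
      split; [intros [x y]; split; [lra|apply Rmin_glb; lra]|].
      intros x. assert (hr := Rmin_r hi (- a / b)). lra.
    * left. intros t ht h'. apply key in h'; [|assumption]. rewrite cut in h'.
      apply h. apply Rmin_glb; lra.
Qed.

Lemma amax_exists (L : list (R * R)) t : L <> nil ->
  exists z, In z L /\ amax (fun z' => In z' L) t z.
Proof.
induction L as [|z L IH]; [congruence|intros _].
destruct L as [|y L].
- exists z; split; [simpl; auto|]. intros z' [<-|[]]; lra.
- destruct IH as [x [hx mx]]; [discriminate|].
  destruct (Rle_dec (val t z) (val t x)).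
  + exists x; split; [simpl in *; tauto|]. intros z' [<-|h]; [assumption|]. apply mx, h.
  + exists z; split; [simpl; auto|]. intros z' [<-|h]; [lra|]. apply mx in h. lra.
Qed.

(** [L] stays fixed while [L0] is exhausted: proper optimality intervals go to [sg], isolated
    parameters to [F]. *)
Lemma amax_segments (L L0 : list (R * R)) : NoDup L0 ->
  exists (sg : list ((R * R) * (R * R))) (F : list R),
    NoDup (map fst sg) /\
    (forall e, In e sg -> In (fst e) L0 /\ 0 <= fst (snd e) /\ fst (snd e) < snd (snd e) /\
       snd (snd e) <= 1 /\ forall t, 0 <= t <= 1 ->
         (amax (fun z' => In z' L) t (fst e) <-> fst (snd e) <= t <= snd (snd e))) /\
    (forall z, In z L0 -> In z (map fst sg) \/
       exists t0, In t0 F /\ forall t, 0 <= t <= 1 -> amax (fun z' => In z' L) t z -> t = t0).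
Proof.
induction 1 as [|z L0 nz nd [sg [F [h1 [h2 h3]]]]].
- exists nil, nil. split; [constructor|]. split; simpl; tauto.
- destruct (amax_interval L z) as [no|[lo [hi [k1 [k2 k3]]]]].
  (* The 0 is a placeholder: this point is optimal for no parameter. *)
  + exists sg, (0 :: F). split; [assumption|split].
    * intros e he. destruct (h2 e he) as [a b]. split; [simpl; auto|exact b].
    * intros y [<-|hy].
      { right. exists 0; split; [simpl; auto|]. intros t ht hm. exfalso; eapply no; eauto. }
      destruct (h3 y hy) as [h|[t0 [a b]]]; [auto|]. right; exists t0; simpl; auto.
  + destruct k1 as [k0 [k1|k1]].
    * exists ((z, (lo, hi)) :: sg), F. split; [|split].
      { simpl. constructor; [|assumption]. intros h. apply in_map_iff in h.
        destruct h as [e [<- he]]. apply nz. apply h2, he. }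
      { intros e [<-|he].
        - simpl. repeat (split; [solve [auto|lra]|]). exact k3.
        - destruct (h2 e he) as [a b]. split; [simpl; auto|exact b]. }
      { intros y [<-|hy]; [left; simpl; auto|].
        destruct (h3 y hy) as [h|h]; [left; simpl; auto|auto]. }
    * exists sg, (lo :: F). split; [assumption|split].
      { intros e he. destruct (h2 e he) as [a b]. split; [simpl; auto|exact b]. }
      { intros y [<-|hy].
        - right. exists lo; split; [simpl; auto|]. intros t ht hm. apply k3 in hm; lra.
        - destruct (h3 y hy) as [h|[t0 [a b]]]; [auto|]. right; exists t0; simpl; auto. }
Qed.

(** Different points have equal value for at most one [t], so proper segments do not overlap, and
    [cover_length] gives total length 1. *)
Lemma envelope_segments (L : list (R * R)) : L <> nil -> NoDup L ->
  exists sg : list ((R * R) * (R * R)),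
    NoDup (map fst sg) /\
    rsum (fun e => snd (snd e) - fst (snd e)) sg = 1 /\
    (forall e, In e sg -> In (fst e) L /\ 0 <= fst (snd e) /\ fst (snd e) < snd (snd e) /\
       snd (snd e) <= 1 /\ forall t, 0 <= t <= 1 ->
         (amax (fun z' => In z' L) t (fst e) <-> fst (snd e) <= t <= snd (snd e))) /\
    (forall z t1 t2, In z L -> 0 <= t1 < t2 -> t2 <= 1 ->
       amax (fun z' => In z' L) t1 z -> amax (fun z' => In z' L) t2 z -> In z (map fst sg)) /\
    (forall t, t = 0 \/ t = 1 -> exists e, In e sg /\ amax (fun z' => In z' L) t (fst e)).
Proof.
intros ne nd. destruct (amax_segments L nd) as [sg [F [h1 [h2 h3]]]].
assert (cov : forall t, 0 <= t <= 1 -> In t F \/ exists e, In e sg /\ fst (snd e) <= t <= snd (snd e)).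
{ intros t ht. destruct (amax_exists t ne) as [z [hz mz]].
  destruct (h3 z hz) as [h|[t0 [a b]]].
  - right. apply in_map_iff in h. destruct h as [e [<- he]]. exists e; split; [assumption|].
    apply (h2 e he); assumption.
  - left. rewrite (b t ht mz). assumption. }
exists sg. split; [assumption|split; [|split; [assumption|split]]].
- replace 1 with (1 - 0) by lra. apply cover_length with F; auto; [lra| |].
  + intros e he. destruct (h2 e he) as [_ [a [b [c _]]]]. lra.
  + intros e e' he he' nee'.
    destruct (h2 e he) as [i1 [a1 [b1 [c1 m1]]]], (h2 e' he') as [i2 [a2 [b2 [c2 m2]]]].
    destruct (Rle_dec (snd (snd e)) (fst (snd e'))) as [h|h]; [auto|].
    destruct (Rle_dec (snd (snd e')) (fst (snd e))) as [h'|h']; [auto|].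
    exfalso. apply nee'.
    set (s := Rmax (fst (snd e)) (fst (snd e'))). set (t := Rmin (snd (snd e)) (snd (snd e'))).
    assert (s1 : fst (snd e) <= s) by apply Rmax_l. assert (s2 : fst (snd e') <= s) by apply Rmax_r.
    assert (t1 : t <= snd (snd e)) by apply Rmin_l. assert (t2 : t <= snd (snd e')) by apply Rmin_r.
    assert (st : s < t).
    { apply Rmax_lub_lt; apply Rmin_glb_lt; lra. }
    assert (eqv : forall r, s <= r <= t -> val r (fst e) = val r (fst e')).
    { intros r hr. apply Rle_antisym.
      - apply m2; auto; lra.
      - apply m1; auto; lra. }
    apply (val_eq_twice st); apply eqv; lra.
- intros z t1 t2 hz ht ht2 m1 m2. destruct (h3 z hz) as [h|[t0 [_ b]]]; [assumption|].
  assert (t1 = t0) by (apply b; [lra|assumption]). assert (t2 = t0) by (apply b; [lra|assumption]). lra.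
- assert (h01 : 0 < 1) by lra. intros t [->| ->].
  (* The left end of the unit interval reduces to the right end by the reflection sending [t] to
     [1 - t]. *)
  + destruct (@cover_hits_right _ (map (fun e => (fst e, (1 - snd (snd e), 1 - fst (snd e)))) sg)
       0 1 (map (fun t => 1 - t) F) h01) as [e' [he' k]].
    * intros e' he'. apply in_map_iff in he'. destruct he' as [e [<- he]]. simpl.
      destruct (h2 e he) as [_ [x1 [x2 [x3 _]]]]. lra.
    * intros t ht. destruct (cov (1 - t)) as [h|[e [he h]]]; [lra| |].
      { left. apply in_map_iff. exists (1 - t); split; [lra|assumption]. }
      { right. exists (fst e, (1 - snd (snd e), 1 - fst (snd e))). split; [|simpl; lra].
        apply in_map_iff. exists e; auto. }
    * apply in_map_iff in he'. destruct he' as [e [<- he]]. simpl in k.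
      exists e; split; [assumption|]. destruct (h2 e he) as [i1 [a1 [b1 [c1 m1]]]]. apply m1; lra.
  + destruct (@cover_hits_right _ sg 0 1 F h01) as [e [he k]]; [|exact cov|].
    * intros e he. apply h2, he.
    * exists e; split; [assumption|]. destruct (h2 e he) as [i1 [a1 [b1 [c1 m1]]]]. apply m1; lra.
Qed.

(** The parameter [t] of the direction [(cos a, sin a)] after scaling to coordinate sum 1. The
    coefficient of a cone is thus the length of its parameter interval. *)
Definition phi (a : R) : R := sin a / (sin a + cos a).

Lemma quadrant_trig a : 0 <= a <= PI / 2 -> 0 <= sin a /\ 0 <= cos a /\ 0 < sin a + cos a.
Proof.
intros h. assert (hp := PI_RGT_0).
assert (s : 0 <= sin a) by (apply sin_ge_0; lra).
assert (c : 0 <= cos a) by (apply cos_ge_0; lra).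
split; [assumption|split; [assumption|]].
assert (e := sin2_cos2 a). unfold Rsqr in e. nra.
Qed.

Lemma phi_range a : 0 <= a <= PI / 2 -> 0 <= phi a <= 1.
Proof.
intros h. destruct (quadrant_trig h) as [s [c sc]]. unfold phi.
split; [apply Rle_mult_inv_pos; assumption|].
apply (Rmult_le_reg_r (sin a + cos a)); [assumption|].
unfold Rdiv. rewrite Rmult_assoc, Rinv_l by lra. lra.
Qed.

Lemma phi_half_plane a x y : 0 <= a <= PI / 2 ->
  (y * cos a <= x * sin a <-> y <= phi a * (x + y)) /\
  (y * cos a >= x * sin a <-> phi a * (x + y) <= y).
Proof.
intros h. destruct (quadrant_trig h) as [s [c sc]].
assert (e : phi a * (sin a + cos a) = sin a) by (unfold phi; field; lra).
set (p := phi a) in *.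
assert (e' : (sin a + cos a) * (y - p * (x + y)) = y * cos a - x * sin a).
{ replace ((sin a + cos a) * (y - p * (x + y)))
    with ((sin a + cos a) * y - (p * (sin a + cos a)) * (x + y)) by ring.
  rewrite e. ring. }
split; split; intros; nra.
Qed.

Lemma phi_le a b : 0 <= a <= PI / 2 -> 0 <= b <= PI / 2 -> phi a <= phi b -> a <= b.
Proof.
intros ha hb h. destruct (Rle_dec a b) as [|n]; [assumption|exfalso].
assert (hp := PI_RGT_0).
assert (s : 0 < sin (a - b)) by (apply sin_gt_0; lra).
rewrite sin_minus in s.
destruct (quadrant_trig ha) as [s1 [c1 sc1]], (quadrant_trig hb) as [s2 [c2 sc2]].
assert (e1 : phi a * (sin a + cos a) = sin a) by (unfold phi; field; lra).
assert (k := proj1 (phi_half_plane (cos b) (sin b) ha)).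
assert (k' := proj1 (phi_half_plane (cos a) (sin a) hb)).
assert (sin a * cos b <= cos a * sin b); [|lra].
apply k'. replace (sin a) with (phi a * (cos a + sin a)) at 1 by lra.
apply Rmult_le_compat_r; lra.
Qed.

Lemma phi_monotone a b : 0 <= a -> a <= b -> b <= PI / 2 -> phi a <= phi b.
Proof.
intros h0 h1 h2. destruct (Rle_dec (phi a) (phi b)) as [|n]; [assumption|exfalso].
assert (e : a = b).
{ apply Rle_antisym; [assumption|]. apply phi_le; lra. }
subst; lra.
Qed.

Lemma phi_surjective t : 0 <= t <= 1 -> exists a, 0 <= a <= PI / 2 /\ phi a = t.
Proof.
intros ht. assert (hp := PI_RGT_0). destruct (Req_dec t 1) as [->|n].
- exists (PI / 2). split; [lra|]. unfold phi. rewrite sin_PI2, cos_PI2. field.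
- set (x := t / (1 - t)).
  assert (hx : 0 <= x) by (apply Rle_mult_inv_pos; lra).
  exists (atan x). split.
  + assert (h := atan_bound x). split; [|lra].
    destruct hx as [hx| <-]; [|rewrite atan_0; lra].
    apply atan_increasing in hx. rewrite atan_0 in hx. lra.
  + unfold phi. rewrite sin_atan, cos_atan.
    assert (hs : 0 < sqrt (1 + x²)) by (apply sqrt_lt_R0; unfold Rsqr; nra).
    set (s := sqrt (1 + x²)) in *.
    replace (x / s / (x / s + 1 / s)) with (x / (x + 1)) by (field; lra).
    unfold x. field. lra.
Qed.

(** * Normal cones and extreme points of the convex hull *)

Lemma conv_incl (P : R * R -> Prop) z : P z -> conv P z.
Proof.
intros h. exists ((1, z) :: nil). simpl. split; [|split].
- intros c [<-|[]]. simpl. split; [lra|assumption].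
- lra.
- destruct z as [x y]. simpl. f_equal; ring.
Qed.

Lemma conv_dotp_le (P : R * R -> Prop) w k z : (forall y, P y -> dotp w y <= k) ->
  conv P z -> dotp w z <= k.
Proof.
intros hk [l [hl [wl ->]]].
assert (h : dotp w (comb l) <= k * weights l); [|rewrite wl in h; lra].
clear wl. induction l as [|[c y] l IH].
- unfold dotp; simpl. lra.
- specialize (IH (fun e he => hl e (or_intror he))).
  destruct (hl _ (or_introl eq_refl)) as [c0 py]. simpl in c0, py.
  specialize (hk y py). unfold dotp in *. simpl. fold (comb l) (weights l).
  assert (x := Rmult_le_compat_l c _ _ c0 hk).
  lra.
Qed.

Lemma dotp_val t z : dotp (1 - t, t) z = val t z.
Proof. reflexivity. Qed.

Definition normal_cone (P : R * R -> Prop) (z w : R * R) : Prop :=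
  0 <= fst w /\ 0 <= snd w /\ forall z', conv P z' -> dotp w z' <= dotp w z.

Lemma amax_conv P t z : amax P t z <-> amax (conv P) t z.
Proof.
split; intros h z' hz'.
- rewrite <- !dotp_val. apply (@conv_dotp_le P); [|assumption]. exact h.
- apply h, conv_incl, hz'.
Qed.

Lemma normal_cone_amax P z t : 0 <= t <= 1 -> (normal_cone P z (1 - t, t) <-> amax P t z).
Proof.
intros ht. rewrite amax_conv. split.
- intros [_ [_ h]]. exact h.
- intros h. split; [simpl; lra|split; [simpl; lra|exact h]].
Qed.

Lemma normal_cone_scale P z w k : 0 < k ->
  (normal_cone P z w <-> normal_cone P z (k * fst w, k * snd w)).
Proof.
intros hk. unfold normal_cone, dotp. simpl. split.
- intros [a [b c]]. split; [nra|split; [nra|]]. intros z' hz'. specialize (c z' hz').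
  rewrite !Rmult_assoc, <- !Rmult_plus_distr_l. apply Rmult_le_compat_l; lra.
- intros [a [b c]]. split; [nra|split; [nra|]]. intros z' hz'. specialize (c z' hz').
  rewrite !Rmult_assoc, <- !Rmult_plus_distr_l in c. apply Rmult_le_reg_l in c; lra.
Qed.

(** A nonzero weight is scaled to sum 1, where the two half planes of the cone turn into the bounds
    on [t]; the zero weight lies in both cones. *)
Lemma normal_cone_angles P z alpha beta : 0 <= beta <= alpha -> alpha <= PI / 2 ->
  (forall t, 0 <= t <= 1 -> (amax P t z <-> phi beta <= t <= phi alpha)) ->
  forall w, normal_cone P z w <-> cone_ab alpha beta w.
Proof.
intros hab ha h [x y].
assert (main : 0 <= x -> 0 <= y -> (normal_cone P z (x, y) <-> phi beta * (x + y) <= y <= phi alpha * (x + y))).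
{ intros hx hy. destruct (Req_dec (x + y) 0) as [e|ne].
  - assert (x = 0) by lra. assert (y = 0) by lra. subst. split; [intros; lra|].
    intros _. split; [simpl; lra|split; [simpl; lra|]]. intros z' _. unfold dotp; simpl; lra.
  - set (s := x + y). assert (hs : 0 < s) by (unfold s; lra).
    rewrite (@normal_cone_scale P z (x, y) (/ s)) by (apply Rinv_0_lt_compat; assumption).
    simpl.
    assert (ht : 0 <= / s * y <= 1).
    { assert (0 < / s) by (apply Rinv_0_lt_compat; assumption). split; [nra|].
      apply (Rmult_le_reg_l s); [assumption|]. rewrite <- Rmult_assoc, Rinv_r by lra. unfold s; lra. }
    replace (/ s * x) with (1 - / s * y) by (unfold s; field; unfold s in hs; lra).
    rewrite normal_cone_amax, h by assumption.
    assert (e : forall k, k * s <= y <-> k <= / s * y).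
    { intros k. assert (ey : y = s * (/ s * y)) by (field; lra). rewrite ey at 1.
      split; intros; [apply (Rmult_le_reg_l s); lra|]. rewrite (Rmult_comm k). apply Rmult_le_compat_l; lra. }
    assert (e' : forall k, y <= k * s <-> / s * y <= k).
    { intros k. assert (ey : y = s * (/ s * y)) by (field; lra). rewrite ey at 1.
      split; intros; [apply (Rmult_le_reg_l s); lra|]. rewrite (Rmult_comm k). apply Rmult_le_compat_l; lra. }
    rewrite e, e'. tauto. }
assert (pa := phi_half_plane x y (conj (Rle_trans _ _ _ (proj1 hab) (proj2 hab)) ha)).
assert (hb : 0 <= beta <= PI / 2) by lra.
assert (pb := phi_half_plane x y hb).
unfold cone_ab. simpl. split.
- intros n. assert (n' := n). destruct n as [n1 [n2 _]]. simpl in n1, n2.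
  apply main in n'; auto. tauto.
- intros [n1 [n2 n3]]. apply main; auto. tauto.
Qed.

(** At the midpoint of the interval [z] is the only maximizer, since equality there forces equality
    at both [lo] and [hi]. *)
Lemma exposed_extreme P z lo hi : P z -> 0 <= lo < hi -> hi <= 1 ->
  amax P lo z -> amax P hi z -> extreme_point (conv P) z /\ cw_maximal (conv P) z.
Proof.
intros pz hlo hhi mlo mhi. apply amax_conv in mlo, mhi.
set (t0 := (lo + hi) / 2).
assert (mid : forall y, val t0 y = (val lo y + val hi y) / 2) by (intros; unfold val, t0; lra).
assert (uniq : forall y, conv P y -> val t0 z <= val t0 y -> y = z).
{ intros y hy hv. assert (h1 := mlo y hy). assert (h2 := mhi y hy).
  rewrite !mid in hv. apply (@val_eq_twice lo hi); lra. }
assert (max : forall y, conv P y -> val t0 y <= val t0 z).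
{ intros y hy. assert (h1 := mlo y hy). assert (h2 := mhi y hy). rewrite !mid. lra. }
split.
- split; [apply conv_incl, pz|]. intros a b t ha hb ht e.
  assert (ev : val t0 z = t * val t0 a + (1 - t) * val t0 b).
  { rewrite e at 1. unfold val. simpl. ring. }
  assert (ma := max a ha). assert (mb := max b hb).
  rewrite (uniq a ha), (uniq b hb); [reflexivity| |]; nra.
- intros y hy h1 h2. apply uniq; [assumption|]. unfold val.
  assert (0 <= t0 <= 1) by (unfold t0; lra). nra.
Qed.

(** The list enumerates the points with nonzero coefficient. Its last two clauses, obtained at
    [t = 0] and [t = 1], later supply a term above [p] and a term above [q]. *)
Lemma envelope (P : R * R -> Prop) (L : list (R * R)) :
  (forall z, P z <-> In z L) -> L <> nil ->
  exists sg : list ((R * R) * R),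
    NoDup (map fst sg) /\ rsum snd sg = 1 /\
    (forall z c, In (z, c) sg -> P z /\ 0 < c /\
       extreme_point (conv P) z /\ cw_maximal (conv P) z /\
       exists alpha beta, 0 <= beta <= alpha /\ alpha <= PI / 2 /\
         (forall w, normal_cone P z w <-> cone_ab alpha beta w) /\
         c = phi alpha - phi beta) /\
    (forall z alpha beta, P z -> 0 <= beta <= alpha -> alpha <= PI / 2 ->
       (forall w, normal_cone P z w <-> cone_ab alpha beta w) ->
       phi alpha - phi beta <> 0 -> In z (map fst sg)) /\
    (exists z c, In (z, c) sg /\ forall z', P z' -> fst z' <= fst z) /\
    (exists z c, In (z, c) sg /\ forall z', P z' -> snd z' <= snd z).
Proof.
intros hL neL.
assert (dec : forall a b : R * R, {a = b} + {a <> b}) by (intros; apply excluded_middle_informative).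
assert (hN : forall z, P z <-> In z (nodup dec L)) by (intros; rewrite nodup_In; apply hL).
assert (neN : nodup dec L <> nil).
{ destruct L as [|z L']; [congruence|]. intros e.
  assert (h : In z (nodup dec (z :: L'))) by (apply nodup_In; simpl; auto). rewrite e in h. destruct h. }
assert (ndN := NoDup_nodup dec L). set (N := nodup dec L) in *.
destruct (envelope_segments neN ndN) as [sg [h1 [h2 [h3 [h4 h5]]]]].
assert (am : forall t z, amax (fun z' => In z' N) t z <-> amax P t z).
{ intros t z. unfold amax. split; intros h z' hz'; apply h; apply hN; assumption. }
exists (map (fun e => (fst e, snd (snd e) - fst (snd e))) sg).
split; [|split; [|split; [|split; [|split]]]].
- rewrite map_map. simpl. exact h1.
- rewrite <- h2. clear. induction sg as [|e sg IH]; simpl; [reflexivity|].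
  f_equal. exact IH.
- intros z c h. apply in_map_iff in h. destruct h as [[y [lo hi]] [e he]]. simpl in e.
  injection e as -> <-. destruct (h3 _ he) as [k1 [k2 [k3 [k4 k5]]]]. simpl in *.
  apply hN in k1. split; [assumption|split; [lra|]].
  destruct (@exposed_extreme P z lo hi) as [x1 x2]; auto; try lra.
  { apply am, k5; lra. } { apply am, k5; lra. }
  split; [assumption|split; [assumption|]].
  destruct (@phi_surjective hi) as [alpha [ra ea]]; [lra|].
  destruct (@phi_surjective lo) as [beta [rb eb]]; [lra|].
  assert (hab : beta <= alpha) by (apply phi_le; lra).
  exists alpha, beta. split; [lra|split; [lra|split; [|lra]]].
  apply normal_cone_angles; [lra|lra|]. intros t ht. rewrite <- am, k5, ea, eb; tauto.
- intros z alpha beta pz hab ha hw ne. rewrite map_map. simpl.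
  assert (ra : 0 <= alpha <= PI / 2) by lra. assert (rb : 0 <= beta <= PI / 2) by lra.
  assert (pa := phi_range ra). assert (pb := phi_range rb).
  assert (mono : phi beta <= phi alpha) by (apply phi_monotone; lra).
  assert (on : forall t, phi beta <= t <= phi alpha -> amax (fun z' => In z' N) t z).
  { intros t ht. apply am. apply normal_cone_amax; [lra|]. apply hw.
    split; [simpl; lra|split; [simpl; lra|split]]; simpl.
    - apply (phi_half_plane (1 - t) t ra). lra.
    - apply (phi_half_plane (1 - t) t rb). lra. }
  apply (h4 z (phi beta) (phi alpha)); [apply hN, pz|lra|lra|apply on; lra|apply on; lra].
- destruct (h5 0) as [e [he me]]; [auto|].
  exists (fst e), (snd (snd e) - fst (snd e)). split; [apply in_map_iff; exists e; auto|].
  intros z' hz'. apply hN in hz'. specialize (me z' hz'). unfold val in me. lra.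
- destruct (h5 1) as [e [he me]]; [auto|].
  exists (fst e), (snd (snd e) - fst (snd e)). split; [apply in_map_iff; exists e; auto|].
  intros z' hz'. apply hN in hz'. specialize (me z' hz'). unfold val in me. lra.
Qed.

(** * Submodularity on an embedded filter *)

Definition maximal_parts V (adj ori : V -> V -> Prop) (p q m a b : V) : Prop :=
  forall u1 a1 b1, parts adj ori p q u1 a1 b1 ->
    (gdist adj m a <= gdist adj m a1)%nat -> (gdist adj m b <= gdist adj m b1)%nat ->
    gdist adj m a1 = gdist adj m a /\ gdist adj m b1 = gdist adj m b.

(** The consequences of submodularity that the descent uses, stated in the graph itself and free of
    convex hulls and cones. *)
Definition submodular_at V (adj ori : V -> V -> Prop) (gdom : V -> Prop) (gv : V -> R) (p q : V) : Prop :=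
  exists m (l : list (V * R)), is_glb ori p q m /\ gdom m /\
    (forall u c, In (u, c) l -> 0 < c /\ gdom u /\
       exists a b, parts adj ori p q u a b /\ maximal_parts adj ori p q m a b) /\
    rsum snd l = 1 /\
    (exists u c, In (u, c) l /\ prec ori p u) /\
    (exists u c, In (u, c) l /\ prec ori q u) /\
    gv p + gv q >= gv m + rsum (fun e => snd e * gv (fst e)) l.

Section Embedding.
Variable V : Type.
Variables adj ori : V -> V -> Prop.
Hypothesis omg : oriented_modular_graph adj ori.
Local Notation d := (gdist adj).
Local Notation btw := (btw adj).
Local Notation le := (prec ori).

Variable z : V.
Variable T : Type.
Variable M : T -> Prop.
Variable leT : T -> T -> Prop.
Variable emb : V -> T.
Variable proj : T -> V.

(** The embedding is kept abstract because it is used twice: [u] goes to [z,u] for the filter of [z]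
    and to [u,z] for its ideal, and [proj] returns the end other than [z]. *)
Definition image (e : T) : Prop := exists a, le z a /\ e = emb a.

Hypothesis emb_carrier : forall u, le z u -> M (emb u).
Hypothesis emb_le : forall a b, le z a -> le z b -> (leT (emb a) (emb b) <-> le a b).
Hypothesis emb_down : forall e b, M e -> le z b -> leT e (emb b) -> image e.
Hypothesis proj_emb : forall u, proj (emb u) = u.
Hypothesis proj_cov : forall e e', cov_adj M leT e e' ->
  (adj (proj e) (proj e') /\ (image e -> image e')) \/ proj e = proj e'.

Lemma emb_covers a b : le z a -> le z b -> (covers M leT (emb a) (emb b) <-> ori b a).
Proof.
intros za zb. split.
- intros [_ [_ [lab [ne mid]]]]. apply emb_le in lab; auto.
  destruct (prec_walk lab) as [n w]. inversion w as [|? c ? k o w']; subst; [congruence|].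
  assert (cb : le c b).
  { destruct (prec_walk lab). clear - w'. induction w'; [apply rt_refl|].
    eapply rt_trans; [eassumption|apply rt_step; assumption]. }
  assert (ac : le a c) by (apply rt_step; exact o).
  assert (zc := prec_trans za ac).
  destruct (mid (emb c)) as [e|e]; auto.
  + apply emb_le; auto.
  + apply emb_le; auto.
  + apply (f_equal proj) in e. rewrite !proj_emb in e. subst c.
    exfalso. eapply (ori_asym omg); exact o.
  + apply (f_equal proj) in e. rewrite !proj_emb in e. subst c. exact o.
- intros o. assert (ab : le a b) by (apply prec_ori, o).
  split; [auto|split; [auto|split; [apply emb_le; auto|split]]].
  + intros e. apply (f_equal proj) in e. rewrite !proj_emb in e. subst b.
    eapply (ori_asym omg); exact o.
  + intros c mc ac cb. destruct (emb_down mc zb cb) as [c' [zc' ->]].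
    apply emb_le in ac, cb; auto.
    assert (x := prec_btw omg ac cb). red in x.
    assert (ba : adj b a) by (apply (ori_adj omg), o).
    rewrite (gdist_sym omg a b), (gdist_adj omg ba) in x.
    destruct (d a c') as [|k] eqn:e.
    * apply (gdist_eq0 omg) in e. subst; auto.
    * assert (e' : d c' b = 0%nat) by lia. apply (gdist_eq0 omg) in e'. subst; auto.
Qed.

Lemma emb_glb a b e : le z a -> le z b ->
  (glb M leT (emb a) (emb b) e <-> exists m, le z m /\ e = emb m /\ is_glb ori a b m).
Proof.
intros za zb. split.
- intros [me [ea [eb gr]]]. destruct (emb_down me za ea) as [m [zm ->]].
  apply emb_le in ea, eb; auto.
  destruct (glb_exists omg za zb) as [n [gn [_ zn]]].
  assert (m = n) as ->; [|eauto].
  apply (prec_antisym omg); [apply (glb_greatest gn); assumption|].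
  apply emb_le; auto. apply gr; auto; apply emb_le; auto; eauto using glb_l, glb_r.
- intros [m [zm [-> gm]]]. split; [auto|].
  split; [apply emb_le; eauto using glb_l|split; [apply emb_le; eauto using glb_r|]].
  intros c mc ca cb. destruct (emb_down mc za ca) as [c' [zc ->]].
  apply emb_le in ca, cb; auto. apply emb_le; auto. apply (glb_greatest gm); assumption.
Qed.

Lemma emb_rank u n : le z u -> (rank M leT (emb z) (emb u) n <-> n = d z u).
Proof.
intros zu. split.
- intros [s [s0 [sn cov]]]. revert u zu sn cov. induction n as [|n IH]; intros u zu sn cov.
  + rewrite s0 in sn. apply (f_equal proj) in sn. rewrite !proj_emb in sn. subst.
    rewrite (gdist_refl omg); reflexivity.
  + assert (c := cov n (Nat.lt_succ_diag_r n)). rewrite sn in c.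
    destruct (emb_down (proj1 c) zu) as [a [za ea]]; [apply c|].
    rewrite ea in c. apply emb_covers in c; auto.
    rewrite (IH a za ea) by (intros; apply cov; lia).
    assert (x := prec_btw omg za (prec_ori c)). red in x.
    rewrite (gdist_sym omg a u), (gdist_adj omg (ori_adj omg c)) in x. lia.
- intros ->. assert (fin : forall n v, le z v -> n = d z v -> rank M leT (emb z) (emb v) n);
    [|apply fin; auto].
  clear u zu. induction n as [|n IH]; intros u zu hn.
  + symmetry in hn. apply (gdist_eq0 omg) in hn. subst u.
    exists (fun _ => emb z). split; [auto|split; [auto|]]. intros; lia.
  + symmetry in hn. rewrite (gdist_sym omg) in hn.
    destruct (gdist_toward omg hn) as [a [ua az]].
    assert (uz : prec (flip ori) u z) by (apply prec_flip, zu).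
    destruct (prec_toward (omg_flip omg) uz ua) as [o za]; [lia|].
    apply prec_flip in za. unfold flip in o.
    destruct (IH a za) as [s [s0 [sn cov]]]; [rewrite (gdist_sym omg); auto|].
    exists (fun i => if i <=? n then s i else emb u). split; [|split].
    * simpl. exact s0.
    * destruct (Nat.leb_spec (S n) n); [lia|reflexivity].
    * intros i hi. destruct (Nat.leb_spec i n); [|lia].
      destruct (Nat.leb_spec (S i) n); [apply cov; lia|].
      assert (i = n) as -> by lia. rewrite sn. apply emb_covers; auto.
Qed.

(** [proj] never lengthens a walk; a walk whose length it preserves moves the projected end at each
    step and so stays in the image. Hence geodesics of the semilattice between embedded elements are
    embedded geodesics. *)
Lemma cov_walk_proj e e' n : walk (cov_adj M leT) e e' n ->
  (d (proj e) (proj e') <= n)%nat /\ (d (proj e) (proj e') = n -> image e -> image e').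
Proof.
induction 1 as [e|e f e' n c w [IH1 IH2]].
- split; [rewrite (gdist_refl omg); lia|auto].
- destruct (proj_cov c) as [[a im]|eq].
  + assert (t := gdist_tri omg (proj e) (proj f) (proj e')).
    rewrite (gdist_adj omg a) in t. split; [lia|]. intros h he. apply IH2; [lia|auto].
  + rewrite eq. split; [lia|]. intros h; lia.
Qed.

Lemma emb_dist a b n : le z a -> le z b -> (dist (cov_adj M leT) (emb a) (emb b) n <-> n = d a b).
Proof.
intros za zb.
assert (w : walk (cov_adj M leT) (emb a) (emb b) (d a b)).
{ assert (g := @geodesic_inside V adj ori omg (le z) a b).
  assert (x : walk (inside adj (le z)) a b (d a b)).
  { apply g. intros y. apply (btw_filter omg za zb). }
  clear g. revert x. generalize (d a b) as k. intros k x.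
  induction x as [x|x y t k [zx [zy xy]] w IH]; [constructor|].
  eapply walk_cons; [|apply IH; auto].
  destruct (adj_ori omg xy) as [o|o]; [right|left]; apply emb_covers; auto. }
assert (lb : forall k, walk (cov_adj M leT) (emb a) (emb b) k -> (d a b <= k)%nat).
{ intros k wk. apply cov_walk_proj in wk. rewrite !proj_emb in wk. apply wk. }
split.
- intros [wn min]. apply Nat.le_antisymm; auto.
- intros ->. split; auto.
Qed.

Lemma emb_interval p q e : le z p -> le z q ->
  (sl_interval M leT (emb p) (emb q) e <-> exists u, le z u /\ e = emb u /\ btw p q u).
Proof.
intros zp zq. split.
- intros [me [n1 [n2 [d1 [d2 d3]]]]]. apply emb_dist in d3; auto.
  assert (w1 := cov_walk_proj (proj1 d1)). assert (w2 := cov_walk_proj (proj1 d2)).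
  rewrite !proj_emb in *. assert (t := gdist_tri omg p (proj e) q).
  destruct w1 as [w1 w1'], w2 as [w2 _].
  destruct w1' as [u [zu ->]]; [lia|exists p; auto|].
  exists u; split; [auto|split; [auto|]]. apply emb_dist in d1, d2; auto. red. lia.
- intros [u [zu [-> b]]]. split; [auto|].
  exists (d p u), (d u q). split; [apply emb_dist; auto|split; apply emb_dist; auto].
Qed.

Section Pair.
Variables p q m : V.
Hypothesis zp : le z p.
Hypothesis zq : le z q.
Hypothesis glb_pq : is_glb ori p q m.

Let zm : le z m := glb_greatest glb_pq zp zq.

Definition point (a b : V) : R * R := (INR (d m a), INR (d m b)).

(** Ranks in the semilattice are counted from [z], those in [point] from the meet [m]; subtracting
    the rank of [m] accounts for the difference. *)
Lemma emb_rvec u v : btw p q u ->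
  (rvec M leT (emb z) (emb p) (emb q) (emb u) v <-> exists a b, parts adj ori p q u a b /\ v = point a b).
Proof.
intros bu. assert (mu := btw_above omg glb_pq bu). assert (zu := prec_trans zm mu).
assert (rk : forall a, le m a -> INR (d z a) - INR (d z m) = INR (d m a)).
{ intros a ma. assert (x := prec_btw omg zm ma). red in x. rewrite <- x, plus_INR. ring. }
split.
- intros [mp [mq [m0 [n1 [n2 [n0 [g1 [g2 [g0 [r1 [r2 [r0 ->]]]]]]]]]]]].
  apply emb_glb in g1, g2, g0; auto.
  destruct g1 as [a [za [-> ga]]], g2 as [b [zb [-> gb]]], g0 as [m' [zm' [-> gm]]].
  assert (m' = m) as -> by (apply (glb_unique omg gm glb_pq)).
  apply emb_rank in r1, r2, r0; auto. subst.
  assert (pt : parts adj ori p q u a b) by (split; auto).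
  destruct (parts_above omg glb_pq pt) as [ma [mb _]].
  exists a, b. split; [assumption|]. unfold point. rewrite !rk by assumption. reflexivity.
- intros [a [b [pt ->]]]. destruct (parts_above omg glb_pq pt) as [ma [mb _]].
  destruct pt as [_ [ga gb]].
  assert (za := prec_trans zm ma). assert (zb := prec_trans zm mb).
  exists (emb a), (emb b), (emb m), (d z a), (d z b), (d z m).
  split; [apply emb_glb; eauto|split; [apply emb_glb; eauto|split; [apply emb_glb; eauto|]]].
  split; [apply emb_rank; auto|split; [apply emb_rank; auto|split; [apply emb_rank; auto|]]].
  unfold point. rewrite !rk by assumption. reflexivity.
Qed.

Definition points (v : R * R) : Prop := exists u a b, parts adj ori p q u a b /\ v = point a b.

Lemma emb_rpoints v : rpoints M leT (emb z) (emb p) (emb q) v <-> points v.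
Proof.
split.
- intros [e [he hr]]. apply emb_interval in he; auto. destruct he as [u [zu [-> bu]]].
  apply emb_rvec in hr; auto. destruct hr as [a [b h]]. exists u, a, b; exact h.
- intros [u [a [b [h ->]]]]. assert (bu := proj1 h).
  assert (zu := prec_trans zm (btw_above omg glb_pq bu)).
  exists (emb u). split; [apply emb_interval; eauto|]. apply emb_rvec; eauto.
Qed.

Lemma parts_unique u a b a' b' : parts adj ori p q u a b -> parts adj ori p q u a' b' -> a = a' /\ b = b'.
Proof.
intros [_ [h1 h2]] [_ [h3 h4]]. split; eapply (glb_unique omg); eassumption.
Qed.

(** The interval may be infinite, but its rank vectors are grid points bounded by the ranks of [p]
    and [q] above [m]. *)
Lemma points_finite : exists L, L <> nil /\ forall v, points v <-> In v L.
Proof.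
set (L0 := flat_map (fun i => map (fun k => (INR i, INR k)) (seq 0 (S (d m q)))) (seq 0 (S (d m p)))).
assert (inL0 : forall v, points v -> In v L0).
{ intros v [u [a [b [h ->]]]]. destruct (parts_above omg glb_pq h) as [ma [mb [ap bq]]].
  assert (x := prec_rank_le omg ma ap). assert (y := prec_rank_le omg mb bq).
  apply in_flat_map. exists (d m a). split; [apply in_seq; lia|].
  apply in_map_iff. exists (d m b). split; [reflexivity|apply in_seq; lia]. }
set (f := fun v => if excluded_middle_informative (points v) then true else false).
assert (hL : forall v, points v <-> In v (filter f L0)).
{ intros v. rewrite filter_In. unfold f.
  destruct (excluded_middle_informative (points v)); split; intros; try tauto; auto.
  destruct H; discriminate. }
exists (filter f L0). split; [|exact hL].
assert (h : points (point p m)) by (exists p, p, m; split; [apply parts_l; auto|reflexivity]).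
apply hL in h. destruct (filter f L0); [destruct h|discriminate].
Qed.

Lemma point_inj a b a' b' : point a b = point a' b' -> d m a = d m a' /\ d m b = d m b'.
Proof. intros h. injection h as h1 h2. split; apply INR_eq; assumption. Qed.

Lemma extreme_parts_unique u a b u' a' b' v : extreme_point (conv points) v ->
  parts adj ori p q u a b -> v = point a b -> parts adj ori p q u' a' b' -> v = point a' b' -> u = u'.
Proof.
intros [_ ex] h e h' e'. apply NNPP; intros ne.
assert (eab : point a b = point a' b') by congruence.
apply point_inj in eab. destruct eab as [ea eb].
destruct (equal_rank_parts omg glb_pq h h' ne ea eb)
  as [u1 [a1 [b1 [u2 [a2 [b2 [k1 [k2 [s1 [s2 no]]]]]]]]]].
apply no. apply point_inj. apply (ex _ _ (1/2)).
- apply conv_incl. exists u1, a1, b1; auto.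
- apply conv_incl. exists u2, a2, b2; auto.
- lra.
- subst v. unfold point; simpl.
  assert (INR (d m a1) + INR (d m a2) = 2 * INR (d m a)).
  { rewrite <- plus_INR, s1, mult_INR. simpl; ring. }
  assert (INR (d m b1) + INR (d m b2) = 2 * INR (d m b)).
  { rewrite <- plus_INR, s2, mult_INR. simpl; ring. }
  f_equal; lra.
Qed.

Lemma emb_Ccone u a b w : parts adj ori p q u a b ->
  (Ccone M leT (emb z) (emb p) (emb q) (emb u) w <-> normal_cone points (point a b) w).
Proof.
intros h. assert (bu := proj1 h).
assert (cv : forall y, conv (rpoints M leT (emb z) (emb p) (emb q)) y <-> conv points y).
{ intros y. unfold conv. split; intros [l [h1 h2]]; exists l; (split; [|assumption]);
    intros c hc; (split; [apply h1, hc|]); apply emb_rpoints, h1, hc. }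
split.
- intros [w1 [w2 [v [hv mx]]]]. apply emb_rvec in hv; auto. destruct hv as [a' [b' [h' ->]]].
  destruct (parts_unique h h') as [<- <-].
  split; [assumption|split; [assumption|]]. intros y hy. apply mx, cv, hy.
- intros [w1 [w2 mx]]. split; [assumption|split; [assumption|]].
  exists (point a b). split; [apply emb_rvec; eauto|]. intros y hy. apply mx, cv, hy.
Qed.
End Pair.

Variable gdom : V -> Prop.
Variable gv : V -> R.
Variable fdom : T -> Prop.
Variable fv : T -> R.
Hypothesis fdom_emb : forall u, fdom (emb u) <-> gdom z /\ gdom u.
Hypothesis fv_emb : forall u, fv (emb u) = (gv z + gv u) / 2.
Hypothesis sub : submodular M leT (emb z) fdom fv.

Lemma submodular_emb p q : le z p -> le z q -> gdom z -> gdom p -> gdom q ->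
  submodular_at adj ori gdom gv p q.
Proof.
intros zp zq gz gp gq.
destruct (glb_exists omg zp zq) as [m [gm [_ zm]]].
destruct (points_finite gm) as [L [neL hL]].
destruct (envelope hL neL) as [sg [nd [sum1 [hsg [cov [hfst hsnd]]]]]].
set (is_pt := fun (v : R * R) (u : V) => exists a b, parts adj ori p q u a b /\ v = point m a b).
(* A representative of the rank vector [v]; for the extreme vectors in [sg] it is the only one. *)
set (U := fun v => epsilon (inhabits p) (is_pt v)).
assert (hU : forall v, points p q m v -> is_pt v (U v)).
{ intros v [u [a [b h]]]. apply epsilon_spec. exists u, a, b; exact h. }
assert (hUs : forall v c, In (v, c) sg -> is_pt v (U v)).
{ intros v c h. apply hU, (hsg v c h). }
set (l := map (fun e => (U (fst e), snd e)) sg).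
assert (inl : forall u c, In (u, c) l -> exists v, In (v, c) sg /\ u = U v).
{ intros u c h. apply in_map_iff in h. destruct h as [[v c'] [e h]]. simpl in e.
  injection e as <- <-. eauto. }
assert (maxim : forall v c a b, In (v, c) sg -> parts adj ori p q (U v) a b -> v = point m a b ->
   maximal_parts adj ori p q m a b).
{ intros v c a b hv h e. destruct (hsg v c hv) as [_ [_ [_ [cw _]]]].
  intros u1 a1 b1 h1 l1 l2.
  assert (eq : point m a1 b1 = v).
  { apply cw.
    - apply conv_incl. exists u1, a1, b1; auto.
    - subst v; simpl. apply le_INR, l1.
    - subst v; simpl. apply le_INR, l2. }
  subst v. apply point_inj in eq. assumption. }
destruct (sub (emb_carrier zp) (emb_carrier zq)) as [em [gem [dem [dE ineq]]]];
  [apply fdom_emb; auto|apply fdom_emb; auto|].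
apply emb_glb in gem; auto. destruct gem as [m' [zm' [-> gm']]].
assert (m' = m) as -> by (apply (glb_unique omg gm' gm)).
assert (coefs : forall v c, In (v, c) sg ->
   Eset M leT (emb z) (emb p) (emb q) (emb (U v)) /\
   coef M leT (emb z) (emb p) (emb q) (emb (U v)) c).
{ intros v c h. destruct (hUs v c h) as [a [b [pt e]]].
  destruct (hsg v c h) as [pv [c0 [ex [cw [alpha [beta [h1 [h2 [h3 h4]]]]]]]]].
  assert (cv : forall y, conv (rpoints M leT (emb z) (emb p) (emb q)) y <-> conv (points p q m) y).
  { intros y. unfold conv. split; intros [k [k1 k2]]; exists k; (split; [|assumption]);
      intros x hx; (split; [apply k1, hx|]); apply (emb_rpoints zp zq gm), k1, hx. }
  split.
  - split.
    + apply emb_interval; auto. exists (U v). split; [|split; [reflexivity|apply pt]].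
      exact (prec_trans zm (btw_above omg gm (proj1 pt))).
    + exists v. split; [|split].
      * apply (emb_rvec zp zq gm); [apply pt|]. exists a, b; auto.
      * destruct ex as [ex1 ex2]. split; [apply cv, ex1|]. intros x y t hx hy. apply ex2; apply cv; assumption.
      * intros y hy. apply cw, cv, hy.
  - exists alpha, beta. split; [assumption|split; [assumption|split; [|exact h4]]].
    intros w. rewrite (emb_Ccone zp zq gm w pt), <- e. apply h3. }
exists m, l. split; [assumption|split; [apply fdom_emb, dem|split; [|split; [|split; [|split]]]]].
- intros u c h. destruct (inl u c h) as [v [hv ->]].
  assert (k := hsg v c hv). split; [apply k|split].
  + destruct (coefs v c hv) as [k1 k2]. apply fdom_emb. apply (dE (emb (U v)) c); auto.
    destruct k as [_ [k _]]. lra.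
  + destruct (hUs v c hv) as [a [b [pt e]]]. exists a, b. split; [assumption|].
    apply (maxim v c a b hv pt e).
- unfold l. rewrite <- sum1. clear. induction sg as [|e sg IH]; simpl; [reflexivity|]. f_equal; exact IH.
- destruct hfst as [v [c [hv mx]]]. destruct (hUs v c hv) as [a [b [pt e]]].
  exists (U v), c. split; [apply in_map_iff; exists (v, c); auto|].
  assert (h : points p q m (point m p m)) by (exists p, p, m; split; [apply parts_l; auto|reflexivity]).
  apply mx in h. subst v. simpl in h. apply INR_le in h.
  destruct (parts_above omg gm pt) as [ma [_ [ap _]]].
  assert (a = p) as <-.
  { apply (prec_rank_eq omg ma ap). apply Nat.le_antisymm; [apply (prec_rank_le omg ma ap)|assumption]. }
  destruct pt as [_ [ga _]]. exact (glb_l ga).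
- destruct hsnd as [v [c [hv mx]]]. destruct (hUs v c hv) as [a [b [pt e]]].
  exists (U v), c. split; [apply in_map_iff; exists (v, c); auto|].
  assert (h : points p q m (point m m q)) by (exists q, m, q; split; [apply parts_r; auto|reflexivity]).
  apply mx in h. subst v. simpl in h. apply INR_le in h.
  destruct (parts_above omg gm pt) as [_ [mb [_ bq]]].
  assert (b = q) as <-.
  { apply (prec_rank_eq omg mb bq). apply Nat.le_antisymm; [apply (prec_rank_le omg mb bq)|assumption]. }
  destruct pt as [_ [_ gb]]. exact (glb_l gb).
- assert (key : fv (emb p) + fv (emb q) >= fv (emb m) +
    fold_right (fun uc acc => snd uc * fv (fst uc) + acc) 0 (map (fun e => (emb (U (fst e)), snd e)) sg)).
  { apply ineq.
    - rewrite map_map. simpl. clear - nd hUs omg proj_emb.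
      induction sg as [|[v c] sg IH]; simpl; [constructor|].
      simpl in nd. inversion nd as [|? ? nv nd']; subst.
      constructor; [|apply IH; [assumption|intros; eapply hUs; simpl; eauto]].
      intros h. apply nv. apply in_map_iff in h. destruct h as [[v' c'] [e h]].
      apply (f_equal proj) in e. rewrite !proj_emb in e. simpl in e.
      destruct (hUs v c (or_introl eq_refl)) as [a [b [pt ->]]].
      destruct (hUs v' c' (or_intror h)) as [a' [b' [pt' e']]].
      rewrite e in pt'. destruct (parts_unique pt pt') as [<- <-].
      apply in_map_iff. exists (v', c'). simpl. auto.
    - intros e. rewrite map_map. simpl. split.
      + intros h. apply in_map_iff in h. destruct h as [[v c] [<- h]]. simpl.
        destruct (coefs v c h) as [k1 k2]. split; [assumption|]. exists c. split; [assumption|].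
        destruct (hsg v c h) as [_ [k _]]. lra.
      + intros [[he [v [hr [ex cw]]]] [c [[alpha [beta [h1 [h2 [h3 h4]]]]] nz]]].
        apply emb_interval in he; auto. destruct he as [u [zu [-> bu]]].
        apply (emb_rvec zp zq gm) in hr; auto. destruct hr as [a [b [pt e]]].
        assert (pv : points p q m v) by (exists u, a, b; auto).
        assert (inv : In v (map fst sg)).
        { apply (cov v alpha beta); auto.
          - intros w. rewrite e, <- (emb_Ccone zp zq gm w pt). apply h3.
          - fold (phi alpha) (phi beta) in h4. lra. }
        apply in_map_iff in inv. destruct inv as [[v' c'] [e' h]]. simpl in e'. subst v'.
        apply in_map_iff. exists (v, c'). split; [|assumption]. simpl. f_equal.
        destruct (hUs v c' h) as [a' [b' [pt' e']]].
        destruct (hsg v c' h) as [_ [_ [ex' _]]].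
        exact (extreme_parts_unique gm ex' pt' e' pt e).
    - intros e c h. apply in_map_iff in h. destruct h as [[v c'] [e' h]]. simpl in e'.
      injection e' as <- <-. apply coefs, h. }
  rewrite !fv_emb in key.
  (* Every value of [fv] carries half of [gv z]; as the weights sum to 1, these halves cancel in the
     inequality. *)
  assert (eq : fold_right (fun uc acc => snd uc * fv (fst uc) + acc) 0 (map (fun e => (emb (U (fst e)), snd e)) sg)
     = (gv z * rsum snd sg + rsum (fun e => snd e * gv (fst e)) l) / 2).
  { unfold l. clear - fv_emb. induction sg as [|e sg IH]; simpl; [lra|].
    rewrite IH, fv_emb. unfold rsum. field. }
  rewrite eq, sum1 in key. lra.
Qed.
End Embedding.

(** * Neighborhood semilattices *)

Definition locally_submodular V (adj ori : V -> V -> Prop) (gdom : V -> Prop) (gv : V -> R) : Prop :=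
  forall z p q, prec ori z p -> prec ori z q -> gdom z -> gdom p -> gdom q ->
    submodular_at adj ori gdom gv p q.

Section Neighborhood.
Variable V : Type.
Variables adj ori : V -> V -> Prop.
Hypothesis omg : oriented_modular_graph adj ori.
Hypothesis wo : well_oriented ori.
Local Notation le := (prec ori).

Lemma Istar_le_iff y w y' w' : le y w -> (Istar_le ori (y, w) (y', w') <-> le y' y /\ le w w').
Proof.
intros yw. unfold Istar_le, in_interval. simpl. split.
- intros h. split; [apply (h y)|apply (h w)]; split; auto using prec_refl.
- intros [h1 h2] u [h3 h4]. split; eauto using prec_trans.
Qed.

Lemma Istar_carrier_iff z y w : Istar_carrier ori z (y, w) <-> le y z /\ le z w.
Proof.
unfold Istar_carrier; simpl. split; [tauto|]. intros [h1 h2].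
split; [|tauto]. apply wo. exact (prec_trans h1 h2).
Qed.

Lemma prec_cover a b : le a b -> a <> b -> exists c, ori c a /\ le c b.
Proof.
intros h ne. apply clos_rt_rtn1 in h. inversion h; subst; [congruence|].
eexists. split; [eassumption|]. apply clos_rtn1_rt. assumption.
Qed.

Lemma prec_cover_below a b : le a b -> a <> b -> exists c, ori b c /\ le a c.
Proof.
intros h ne. apply clos_rt_rt1n in h. inversion h; subst; [congruence|].
eexists. split; [eassumption|]. apply clos_rt1n_rt. assumption.
Qed.

(** If both ends changed, the interval [y,w'] would lie strictly between the two. *)
Lemma Istar_covers z e e' : covers (Istar_carrier ori z) (Istar_le ori) e e' ->
  (fst e = fst e' /\ adj (snd e) (snd e')) \/ (snd e = snd e' /\ adj (fst e) (fst e')).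
Proof.
destruct e as [y w], e' as [y' w']. simpl.
intros [m [m' [l [ne mid]]]].
apply Istar_carrier_iff in m, m'. destruct m as [yz zw], m' as [yz' zw'].
assert (yw := prec_trans yz zw).
apply Istar_le_iff in l; [|assumption]. destruct l as [ly lw].
assert (mid' : forall s t, le s z -> le z t -> le s y -> le y' s -> le w t -> le t w' ->
   (s, t) = (y, w) \/ (s, t) = (y', w')).
{ intros s t h1 h2 h3 h4 h5 h6. apply mid.
  - apply Istar_carrier_iff; auto.
  - apply Istar_le_iff; auto.
  - apply Istar_le_iff; [exact (prec_trans h1 h2)|auto]. }
destruct (classic (w = w')) as [<-|nw].
- right. split; [reflexivity|]. assert (ny : y' <> y) by congruence.
  destruct (prec_cover_below ly ny) as [c [o yc]].
  assert (cy : le c y) by (apply rt_step; exact o).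
  destruct (mid' c w) as [h|h]; auto using prec_refl.
  + exact (prec_trans cy yz).
  + injection h as ->. exfalso. exact (ori_asym omg o o).
  + injection h as ->. exact (ori_adj omg o).
- left. destruct (mid' y w') as [h|h]; auto using prec_refl; [congruence|].
  injection h as <-. split; [reflexivity|].
  destruct (prec_cover lw nw) as [c [o cw]].
  assert (wc : le w c) by (apply rt_step; exact o).
  destruct (mid' y c) as [h|h]; auto using prec_refl.
  + exact (prec_trans zw wc).
  + injection h as ->. exfalso. exact (ori_asym omg o o).
  + injection h as ->. apply (adj_sym omg). exact (ori_adj omg o).
Qed.

Lemma Istar_cov_adj z e e' : cov_adj (Istar_carrier ori z) (Istar_le ori) e e' ->
  (fst e = fst e' /\ adj (snd e) (snd e')) \/ (snd e = snd e' /\ adj (fst e) (fst e')).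
Proof.
intros [h|h]; apply Istar_covers in h; [assumption|].
destruct h as [[h1 h2]|[h1 h2]]; apply (adj_sym omg) in h2; auto.
Qed.

Lemma cov_adj_carrier z e e' : cov_adj (Istar_carrier ori z) (Istar_le ori) e e' ->
  Istar_carrier ori z e'.
Proof. intros [h|h]; apply h. Qed.

Variable gdom : V -> Prop.
Variable gv : V -> R.
Hypothesis Lc : L_convex ori gdom gv.

Lemma L_convex_filters : locally_submodular adj ori gdom gv.
Proof.
intros z p q zp zq gz gp gq.
apply (@submodular_emb V adj ori omg z (V * V) (Istar_carrier ori z) (Istar_le ori)
  (fun u => (z, u)) snd) with (fdom := gstar_dom gdom) (fv := gstar_val gv); auto.
- intros u zu. apply Istar_carrier_iff. auto using prec_refl.
- intros a b za zb. rewrite Istar_le_iff by assumption. split; [tauto|auto using prec_refl].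
- intros [y w] b m zb l. apply Istar_carrier_iff in m. destruct m as [yz zw].
  apply Istar_le_iff in l; [|exact (prec_trans yz zw)].
  exists w. split; [assumption|]. f_equal. apply (prec_antisym omg); tauto.
- intros e e' h. assert (c := cov_adj_carrier h). apply Istar_cov_adj in h.
  destruct h as [[h1 h2]|[h1 h2]]; [left|right; assumption].
  split; [assumption|]. intros [a [za ->]]. destruct e' as [y w]. simpl in h1; subst y.
  apply Istar_carrier_iff in c. exists w; tauto.
- intros u. unfold gstar_dom; simpl. tauto.
- exact (proj2 Lc z).
Qed.

Lemma L_convex_ideals : locally_submodular adj (flip ori) gdom gv.
Proof.
intros z p q zp zq gz gp gq.
apply (@submodular_emb V adj (flip ori) (omg_flip omg) z (V * V) (Istar_carrier ori z) (Istar_le ori)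
  (fun u => (u, z)) fst) with (fdom := gstar_dom gdom) (fv := gstar_val gv); auto.
- intros u zu. apply prec_flip in zu. apply Istar_carrier_iff. auto using prec_refl.
- intros a b za zb. rewrite prec_flip in *.
  rewrite Istar_le_iff by assumption. split; [tauto|auto using prec_refl].
- intros [y w] b m zb l. apply prec_flip in zb.
  apply Istar_carrier_iff in m. destruct m as [yz zw].
  apply Istar_le_iff in l; [|exact (prec_trans yz zw)].
  exists y. split; [apply prec_flip; assumption|]. f_equal. apply (prec_antisym omg); tauto.
- intros e e' h. assert (c := cov_adj_carrier h). apply Istar_cov_adj in h.
  destruct h as [[h1 h2]|[h1 h2]]; [right; assumption|left].
  split; [assumption|]. intros [a [za ->]]. destruct e' as [y w]. simpl in h1; subst w.
  apply Istar_carrier_iff in c. exists y. split; [apply prec_flip; tauto|reflexivity].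
- intros u. unfold gstar_dom; simpl. tauto.
- intros u. unfold gstar_val; simpl. lra.
- exact (proj2 Lc z).
Qed.
End Neighborhood.

(** * Local and global minimality *)

Lemma rsum_ge_term A (f : A -> R) l x : (forall y, In y l -> 0 <= f y) -> In x l -> f x <= rsum f l.
Proof.
induction l as [|y l IH]; intros h hx; [destruct hx|].
simpl. fold (rsum f l). assert (h0 : 0 <= rsum f l).
{ assert (e : rsum (fun _ : A => 0) l = 0) by (clear; induction l; simpl; [reflexivity|unfold rsum in *; lra]).
  rewrite <- e. apply rsum_le. intros; apply h; simpl; auto. }
assert (hy := h y (or_introl eq_refl)).
destruct hx as [<-|hx]; [lra|].
assert (f x <= rsum f l); [|lra]. apply IH; auto. intros; apply h; simpl; auto.
Qed.

Section Paths.
Variable V : Type.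
Variables adj ori : V -> V -> Prop.
Local Notation d := (gdist adj).
Local Notation le := (prec ori).

Definition cmp (a b : V) : Prop := le a b \/ le b a.

(* The last index bounds the total graph length of the steps. *)
Inductive path (P : V -> Prop) : V -> V -> nat -> Prop :=
| path_nil : forall a L, P a -> path P a a L
| path_cons : forall a a' b L L', P a -> cmp a a' -> path P a' b L' ->
    (d a a' + L' <= L)%nat -> path P a b L.

Lemma path_mono (P Q : V -> Prop) a b L L' : (forall v, P v -> Q v) -> (L <= L')%nat ->
  path P a b L -> path Q a b L'.
Proof.
intros h hL p. revert L' hL. induction p as [a L pa|a a' b L L0 pa c p IH hl]; intros L' hL.
- apply path_nil; auto.
- apply path_cons with a' L0; auto. lia.
Qed.

Lemma path_app (P : V -> Prop) a b c L1 L2 : path P a b L1 -> path P b c L2 ->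
  path P a c (L1 + L2).
Proof.
intros p q. induction p as [a L pa|a a' b L L0 pa cm p IH hl].
- apply path_mono with P L2; auto. lia.
- apply path_cons with a' (L0 + L2)%nat; auto. lia.
Qed.

Lemma path_start (P : V -> Prop) a b L : path P a b L -> P a.
Proof. destruct 1; assumption. Qed.

Lemma path_max (P : V -> Prop) (g : V -> R) a b L : path P a b L ->
  exists v, P v /\ path (fun u => P u /\ g u <= g v) a b L.
Proof.
induction 1 as [a L pa|a a' b L L0 pa cm p [v [pv IH]] hl].
- exists a. split; [assumption|]. apply path_nil. split; [assumption|lra].
- destruct (Rle_dec (g a) (g v)) as [h|h].
  + exists v. split; [assumption|]. apply path_cons with a' L0; auto.
  + exists a. split; [assumption|]. apply path_cons with a' L0; auto.
    * split; [assumption|lra].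
    * apply path_mono with (fun u => P u /\ g u <= g v) L0; auto.
      intros u [h1 h2]. split; [assumption|lra].
Qed.
End Paths.

Lemma cmp_flip V (ori : V -> V -> Prop) a b : cmp (flip ori) a b <-> cmp ori a b.
Proof. unfold cmp. rewrite !prec_flip. tauto. Qed.

Lemma path_flip V (adj ori : V -> V -> Prop) P a b L :
  path adj ori P a b L -> path adj (flip ori) P a b L.
Proof.
induction 1 as [a L pa|a a' b L L0 pa cm p IH hl]; [apply path_nil; auto|].
apply path_cons with a' L0; auto. apply cmp_flip; assumption.
Qed.

(** * Detours around high vertices and retraction of paths into a convex set *)

Section Upward.
Variable V : Type.
Variables adj ori : V -> V -> Prop.
Hypothesis omg : oriented_modular_graph adj ori.
Variable gdom : V -> Prop.
Variable gv : V -> R.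
Hypothesis sub : locally_submodular adj ori gdom gv.
Local Notation d := (gdist adj).
Local Notation btw := (btw adj).
Local Notation le := (prec ori).
Local Notation cmp := (cmp ori).
Local Notation path := (path adj ori).
Local Notation down := (upset (flip ori)).

Lemma btw_sub p q u v : btw p q u -> btw p u v -> btw p q v.
Proof.
intros h1 h2. red in h1, h2 |- *.
assert (t1 := gdist_tri omg p v q). assert (t2 := gdist_tri omg v u q). lia.
Qed.

(** Confines paths of bounded length to a ball on which values can be ranked by natural numbers. *)
Lemma path_ball (P : V -> Prop) x b L : path P x b L ->
  path (fun v => P v /\ (d x v <= L)%nat) x b L.
Proof.
intros p. assert (gen : forall a L' , path P a b L' -> (d x a + L' <= L)%nat ->
   path (fun v => P v /\ (d x v <= L)%nat) a b L').
{ clear p. induction 1 as [a L' pa|a a' b L' L0 pa cm p IH hl]; intros hx.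
  - apply path_nil. split; [assumption|lia].
  - apply path_cons with a' L0; auto; [split; [assumption|lia]|].
    apply IH. assert (t := gdist_tri omg x a a'). lia. }
apply gen; [assumption|]. rewrite (gdist_refl omg). lia.
Qed.

(* If no interior [u] of the submodularity inequality has value below [M], its right-hand side exceeds the left-hand one. *)
Lemma shortcut z p q M : le z p -> le z q -> gdom z -> gdom p -> gdom q ->
  gv p <= M -> gv q < M ->
  exists v L, cmp p v /\ (d p v + L <= d p q)%nat /\
    path (fun u => btw p q u /\ gdom u /\ gv u < M) v q L.
Proof.
intros zp zq gz. remember (d p q) as n eqn:hn. revert p q zp zq hn.
induction n as [n IH] using (well_founded_induction lt_wf).
intros p q zp zq hn gp gq pM qM.
assert (direct : cmp p q -> exists v L, cmp p v /\ (d p v + L <= n)%nat /\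
    path (fun u => btw p q u /\ gdom u /\ gv u < M) v q L).
{ intros h. exists q, 0%nat. split; [assumption|split; [lia|]].
  apply path_nil. split; [apply (btw_refl_r omg)|auto]. }
destruct (classic (cmp p q)) as [h|ncmp]; [auto|]. clear direct.
assert (npq : ~ le p q) by (intros h; apply ncmp; left; exact h).
assert (nqp : ~ le q p) by (intros h; apply ncmp; right; exact h).
destruct (sub zp zq gz gp gq) as [m [l [gm [dm [hl [sum1 [[ua [ca [ha pa]]] [[ub [cb [hb qb]]] ineq]]]]]]]].
destruct (Rlt_dec (gv m) M) as [hm|hm].
{ assert (bm := glb_btw omg gm).
  exists m, (d m q). split; [right; exact (glb_l gm)|split; [red in bm; lia|]].
  apply path_cons with q 0%nat; [auto|left; exact (glb_r gm)| |lia].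
  apply path_nil. split; [apply (btw_refl_r omg)|auto]. }
assert (ex : exists u c, In (u, c) l /\ u <> p /\ u <> q /\ gv u < M).
(* The term above [q] is not [p] and the term above [p] is not [q], so [p] and [q] each have total
   weight below 1. With all other terms and [gv m] at least [M], the inequality contradicts
   [gv q < M]. *)
{ apply NNPP; intros no. assert (hm' : M <= gv m) by lra.
  set (ind := fun (v : V) (e : V * R) => if excluded_middle_informative (fst e = v) then snd e else 0).
  assert (c0 : forall e, In e l -> 0 < snd e) by (intros [u c] h; apply (hl u c h)).
  assert (lb : rsum (fun e => (0 + (gv p - M) * ind p e) + (gv q - M) * ind q e) l
      <= rsum (fun e => snd e * gv (fst e) + (- M) * snd e) l).
  { apply rsum_le. intros [u c] h. unfold ind; simpl. assert (c0' := c0 _ h). simpl in c0'.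
    assert (pq : p <> q) by (intros ->; apply npq, prec_refl).
    destruct (excluded_middle_informative (u = p)) as [-> |n1];
    destruct (excluded_middle_informative (_ = q)) as [e2|n2]; try congruence.
    - lra.
    - subst u. lra.
    - assert (M <= gv u); [|nra]. apply Rnot_lt_le. intros hlt. apply no. exists u, c. auto. }
  rewrite !rsum_lin, sum1 in lb.
  assert (z0 : rsum (fun _ : V * R => 0) l = 0).
  { clear. induction l; simpl; [reflexivity|unfold rsum in *; lra]. }
  assert (below : forall v u c, In (u, c) l -> u <> v -> rsum (ind v) l <= 1 - c).
  { intros v u c h ne.
    assert (t := @rsum_ge_term _ (fun e => snd e + (-1) * ind v e) l (u, c)).
    rewrite rsum_lin, sum1 in t. simpl in t. unfold ind at 2 in t. simpl in t.
    destruct (excluded_middle_informative (u = v)); [contradiction|].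
    assert (c + -1 * 0 <= 1 + -1 * rsum (ind v) l); [|lra]. apply t; [|assumption].
    intros e he. assert (c0' := c0 e he). unfold ind.
    destruct (excluded_middle_informative (fst e = v)); lra. }
  assert (b1 := below q ua ca ha (fun e => npq (eq_ind ua (fun x => le p x) pa q e))).
  assert (b2 := below p ub cb hb (fun e => nqp (eq_ind ub (fun x => le q x) qb p e))).
  assert (ca0 := c0 _ ha). assert (cb0 := c0 _ hb). simpl in ca0, cb0. nra. }
destruct ex as [u [c [hu [up_ [uq uM]]]]].
destruct (hl u c hu) as [_ [gu [a [b [[bu _] _]]]]].
assert (zu : le z u) by (apply (btw_filter omg zp zq bu)).
assert (d1 : d p u <> 0%nat) by (intros e; apply (gdist_eq0 omg) in e; auto).
assert (d2 : d u q <> 0%nat) by (intros e; apply (gdist_eq0 omg) in e; auto).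
assert (bu' := bu). red in bu'.
(* Split at [u]: since [u] is on a geodesic, the two detours together are no longer than [d p q]. *)
destruct (IH (d p u)) with (p := p) (q := u) as [v1 [L1 [k1 [k2 k3]]]]; auto; [lia|].
destruct (IH (d u q)) with (p := u) (q := q) as [v2 [L2 [j1 [j2 j3]]]]; auto; [lia|lra|].
exists v1, (L1 + d u q)%nat. split; [assumption|split; [lia|]].
apply path_app with u.
- apply path_mono with (3 := k3); [|lia]. intros v [h1 h2]. split; [|assumption].
  exact (btw_sub bu h1).
- apply path_cons with v2 L2; auto.
  apply path_mono with (3 := j3); [|lia]. intros v [h1 h2]. split; [|assumption].
  apply (btw_sym omg). apply (btw_sym omg) in bu, h1. exact (btw_sub bu h1).
Qed.

(** Pushes a path from the down-set of [C] into [C]; only the start has to move, to a comparable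
    vertex. *)
Lemma retract (C : V -> Prop) a b L : convex adj C -> up_closed ori C -> C b ->
  path (fun v => down C v /\ gdom v) a b L ->
  exists a' L', cmp a a' /\ path (fun v => C v /\ gdom v) a' b L'.
Proof.
intros cv uc cb p. induction p as [a L [ca ga]|a a1 b L L0 [ca ga] cm p IH hl].
- exists a, 0%nat. split; [left; apply prec_refl|]. apply path_nil; auto.
- destruct (IH cb) as [a2 [L2 [cm2 p2]]].
  destruct (path_start p) as [_ ga1]. destruct (path_start p2) as [ca2 ga2].
  destruct (classic (C a1)) as [ca1|nca1].
  { exists a1, (d a1 a2 + L2)%nat. split; [assumption|]. apply path_cons with a2 L2; auto. }
  assert (a12 : le a1 a2).
  { destruct cm2 as [h|h]; [assumption|]. exfalso. apply nca1. exact (uc _ _ ca2 h). }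
  destruct cm as [h|a1a].
  { exists a2, L2. split; [left; exact (prec_trans h a12)|assumption]. }
  (* The remaining case is a corner with [a1] below both [a] and [a2]; the term [u] above [a] serves
     as the new start. *)
  destruct (sub a12 a1a ga1 ga2 ga) as [m [l [gm [dm [hm [_ [_ [[u [c [hu au]]] _]]]]]]]].
  destruct (hm u c hu) as [_ [gu [x [y [pt mx]]]]].
  destruct ca as [k [ck ak]]. apply prec_flip in ak.
  (* This median lies in [C] and above [a]; by maximality of the coordinates of [u] it lies below
     [u], so [u] is in [C]. *)
  destruct (median omg a2 k a) as [n [n1 [n2 n3]]].
  assert (cn : C n) by exact (cv _ _ _ ca2 ck n1).
  apply (btw_sym omg) in n2, n3. destruct (btw_prec omg ak n2) as [an _].
  destruct (parts_exist omg gm n3) as [s [t pn]].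
  assert (sx := maximal_parts_above omg gm pt mx pn an).
  assert (nu : le n u).
  { apply (lub_least (parts_lub omg pn)).
    - exact (prec_trans sx (lub_l (parts_lub omg pt))).
    - destruct (parts_above omg gm pn) as [_ [_ [_ ta]]]. exact (prec_trans ta au). }
  assert (cu : C u) by exact (uc _ _ cn nu).
  assert (a1u : le a1 u) by exact (prec_trans a1a au).
  (* The vertices [u] and [a2] are linked through their meet, which is in the domain by
     submodularity and in [C] by convexity. *)
  destruct (sub a12 a1u ga1 ga2 gu) as [m2 [_ [gm2 [dm2 _]]]].
  assert (cm2' : C m2) by exact (cv _ _ _ ca2 cu (glb_btw omg gm2)).
  exists u, (d u m2 + (d m2 a2 + L2))%nat. split; [left; assumption|].
  apply path_cons with m2 (d m2 a2 + L2)%nat; auto.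
  { right; exact (glb_r gm2). }
  apply path_cons with a2 L2; auto. left; exact (glb_l gm2).
Qed.
End Upward.

Section Global.
Variable V : Type.
Variables adj ori : V -> V -> Prop.
Hypothesis omg : oriented_modular_graph adj ori.
Variable gdom : V -> Prop.
Variable gv : V -> R.
Hypothesis subF : locally_submodular adj ori gdom gv.
Hypothesis subI : locally_submodular adj (flip ori) gdom gv.
Local Notation d := (gdist adj).
Local Notation btw := (btw adj).
Local Notation le := (prec ori).
Local Notation cmp := (cmp ori).
Local Notation path := (path adj ori).
Local Notation down := (upset (flip ori)).

Definition half_closed (C : V -> Prop) : Prop := up_closed ori C \/ up_closed (flip ori) C.

Lemma upset_incl ori' (C : V -> Prop) v : C v -> upset ori' C v.
Proof. intros h; exists v; split; [assumption|apply prec_refl]. Qed.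

Lemma upset_up_closed (ori' : V -> V -> Prop) C : up_closed ori' (upset ori' C).
Proof. intros a b [c [cc ca]] ab. exists c. split; [assumption|exact (prec_trans ca ab)]. Qed.

(** Induction with [C] generalised: for up-closed [C] the down-set contains the next vertex, so the
    rest of the path can be moved into it, and [retract] leads back to [C]. The other case is
    dual. *)
Lemma connected_in_convex a b L : path gdom a b L ->
  forall C, convex adj C -> half_closed C -> C a -> C b ->
  exists L', path (fun v => C v /\ gdom v) a b L'.
Proof.
induction 1 as [a L ga|a a1 b L L0 ga cm p IH hl]; intros C cv hc ca cb.
- exists 0%nat. apply path_nil; auto.
- destruct hc as [uc|dc].
  + destruct (IH (down C)) as [L1 p1]; auto using upset_incl.
    * apply (convex_upset (omg_flip omg)), cv.
    * right. apply upset_up_closed.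
    * destruct cm as [h|h]; [apply upset_incl; exact (uc _ _ ca h)|].
      exists a. split; [assumption|]. apply prec_flip, h.
    * destruct (@retract V adj ori omg gdom gv subF C a b (d a a1 + L1)) as [a' [L' [c' p']]]; auto.
      { apply path_cons with a1 L1; auto. split; auto using upset_incl. }
      exists (d a a' + L')%nat. apply path_cons with a' L'; auto.
  + destruct (IH (upset ori C)) as [L1 p1]; auto using upset_incl.
    * apply (convex_upset omg), cv.
    * left. apply upset_up_closed.
    * destruct cm as [h|h]; [exists a; auto|].
      apply upset_incl. apply prec_flip in h. exact (dc _ _ ca h).
    * destruct (@retract V adj (flip ori) (omg_flip omg) gdom gv subI C a b (d a a1 + L1)) as [a' [L' [c' p']]]; auto.
      { apply path_flip. apply path_cons with a1 L1; auto. split; auto using upset_incl. }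
      apply cmp_flip in c'. apply path_flip in p'.
      exists (d a a' + L')%nat. apply path_cons with a' L'; auto.
Qed.

(** Vertices of value [M] are bypassed from the end [b] backwards. The start [a] may itself have
    value [M], so the lowered path begins at a vertex [a'] comparable to it. *)
Lemma lower_path (C : V -> Prop) M a b L : convex adj C -> gv b < M ->
  path (fun v => (C v /\ gdom v) /\ gv v <= M) a b L ->
  exists a' L', cmp a a' /\ (d a a' + L' <= L)%nat /\
    path (fun v => (C v /\ gdom v) /\ gv v < M) a' b L'.
Proof.
intros cv bM p. induction p as [a L [ca ga]|a a1 b L L0 [[ca ga] aM] cm p IH hl].
- exists a, 0%nat. split; [left; apply prec_refl|]. rewrite (gdist_refl omg).
  split; [lia|]. apply path_nil; auto.
- destruct (IH bM) as [a2 [L2 [cm2 [hl2 p2]]]].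
  destruct (path_start p) as [[ca1 ga1] a1M]. destruct (path_start p2) as [[ca2 ga2] a2M].
  destruct (Rlt_dec (gv a1) M) as [h|h].
  { exists a1, L0. split; [assumption|split; [assumption|]]. apply path_cons with a2 L2; auto. }
  assert (t := gdist_tri omg a a1 a2).
  assert (direct : cmp a a2 -> exists a' L', cmp a a' /\ (d a a' + L' <= L)%nat /\
    path (fun v => (C v /\ gdom v) /\ gv v < M) a' b L').
  { intros c. exists a2, L2. split; [assumption|split; [lia|assumption]]. }
  assert (detour : forall v L1, cmp a v -> (d a v + L1 <= d a a2)%nat ->
     path (fun u => btw a a2 u /\ gdom u /\ gv u < M) v a2 L1 ->
     exists a' L', cmp a a' /\ (d a a' + L' <= L)%nat /\
       path (fun v => (C v /\ gdom v) /\ gv v < M) a' b L').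
  { intros v L1 c hv pv. exists v, (L1 + L2)%nat. split; [assumption|split; [lia|]].
    apply path_app with a2; [|assumption].
    apply path_mono with (3 := pv); [|lia]. intros u [bu [gu uM]]. split; [split|]; auto.
    exact (cv _ _ _ ca ca2 bu). }
  (* In a monotone triple [a1] is simply skipped; only when [a] and [a2] are on the same side of
     [a1] is a detour needed. *)
  destruct cm as [h1|h1], cm2 as [h2|h2].
  + apply direct. left. exact (prec_trans h1 h2).
  + apply prec_flip in h1, h2.
    destruct (shortcut (omg_flip omg) subI h1 h2 ga1 ga ga2 aM a2M) as [v [L1 [c [hv pv]]]].
    apply cmp_flip in c. apply path_flip in pv. exact (detour v L1 c hv pv).
  + destruct (shortcut omg subF h1 h2 ga1 ga ga2 aM a2M) as [v [L1 [c [hv pv]]]].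
    exact (detour v L1 c hv pv).
  + apply direct. right. exact (prec_trans h2 h1).
Qed.

Hypothesis dom_connected : forall a b, gdom a -> gdom b -> exists L, path gdom a b L.

(* Makes induction on the maximal value of [gv] along a path of bounded length well-founded. *)
Hypothesis value_rank : forall alpha x L, exists rho : V -> nat, forall a b, gdom a -> gdom b ->
  (d x a <= L)%nat -> (d x b <= L)%nat -> alpha <= gv a -> gv a < gv b -> (rho a < rho b)%nat.

Lemma local_min_global (C : V -> Prop) x y : convex adj C -> half_closed C ->
  C x -> gdom x -> (forall z, C z -> gdom z -> cmp x z -> gv x <= gv z) ->
  C y -> gdom y -> gv x <= gv y.
Proof.
intros cv hc cx gx loc cy gy. apply Rnot_lt_le; intros lt.
destruct (dom_connected gx gy) as [L0 p0].
destruct (connected_in_convex p0 cv hc cx cy) as [L p]. clear L0 p0.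
destruct (value_rank (gv x) x L) as [rho hr].
apply (path_ball omg) in p.
set (Q := fun v => (C v /\ gdom v) /\ (d x v <= L)%nat) in p.
(* Induction on the rank of the maximal value. Vertices below [gv x] are left out, since [rho] is
   monotone only from [gv x] on. *)
assert (claim : forall r, path (fun v => Q v /\ (gv x <= gv v -> (rho v <= r)%nat)) x y L -> False).
{ induction r as [r IH] using (well_founded_induction lt_wf). intros q.
  destruct (path_max gv q) as [v [[[[cv' gv'] bv] rv] q']].
  assert (xv : gv x <= gv v) by apply (path_start q').
  assert (yv : gv y < gv v) by lra.
  destruct (@lower_path C (gv v) x y L cv yv) as [a' [L' [c [hl pa]]]].
  { apply path_mono with (3 := q'); [|lia]. intros u [[[h1 _] _] h2]. auto. }
  destruct (path_start pa) as [[ca ga] av].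
  (* If the maximum exceeds [gv x], then [x] can be put back in front of the lowered path; if it
     equals [gv x], then [a'] contradicts local minimality. *)
  destruct xv as [xv|xv].
  2:{ assert (h := loc a' ca ga c). lra. }
  assert (rxv : (rho x < rho v)%nat).
  { apply hr; auto; [rewrite (gdist_refl omg); lia|lra]. }
  assert (rv' : (rho v <= r)%nat) by (apply rv; lra).
  apply (IH (pred r)); [lia|].
  assert (pp : path (fun v0 => (C v0 /\ gdom v0) /\ gv v0 < gv v) x y L).
  { apply path_cons with a' L'; auto. }
  apply (path_ball omg) in pp. apply path_mono with (3 := pp); [|lia].
  intros u [[[h1 h2] h3] h4]. split; [split; auto|]. intros hx.
  assert (rho u < rho v)%nat by (apply hr; auto). lia. }
assert (bound : exists r, path (fun v => Q v /\ (gv x <= gv v -> (rho v <= r)%nat)) x y L).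
{ destruct (path_max (fun v => INR (rho v)) p) as [v [_ p']].
  exists (rho v). apply path_mono with (3 := p'); [|lia].
  intros u [h1 h2]. split; [assumption|]. intros _. apply INR_le, h2. }
destruct bound as [r hb]. exact (claim r hb).
Qed.

Lemma steepest_step K w v : convex adj K -> up_closed ori K ->
  K w -> gdom w -> (forall z, K z -> gdom z -> gv w <= gv z) ->
  gdom v -> le v w -> (forall z, gdom z -> le z w -> gv v <= gv z) ->
  forall z, down K z -> gdom z -> gv v <= gv z.
Proof.
intros cv uc kw gw minw dv vw minv z kz gz.
apply (@local_min_global (down K) v z); auto.
- apply (convex_upset (omg_flip omg)), cv.
- right. apply upset_up_closed.
- exists w. split; [assumption|apply prec_flip, vw].
- clear z kz gz. intros z kz gz [vz|zv].
  2:{ apply minv; [assumption|exact (prec_trans zv vw)]. }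
  destruct kz as [k [kk zk]]. apply prec_flip in zk.
  destruct (subF vw vz dv gw gz) as [m [l [gm [dm [hl [sum1 [_ [_ ineq]]]]]]]].
  assert (vm := minv m dm (glb_l gm)).
  (* The median is an element of [K] above [z]; its meet [s] with [w] is on a geodesic between
     elements of [K], and maximality of coordinates puts [s] below every term, hence every term in
     [K]. *)
  destruct (median omg w k z) as [n [n1 [n2 n3]]].
  assert (kn : K n) by exact (cv _ _ _ kw kk n1).
  apply (btw_sym omg) in n2, n3. destruct (btw_prec omg zk n2) as [zn _].
  destruct (parts_exist omg gm n3) as [s [t pn]].
  assert (ks : K s).
  { apply (cv n w); auto. destruct pn as [_ [gs _]]. exact (glb_btw omg gs). }
  assert (lower : forall u c, In (u, c) l -> 0 < c /\ gv w <= gv u).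
  { intros u c hu. destruct (hl u c hu) as [c0 [gu [a [b [pt mx]]]]].
    split; [assumption|]. apply minw; [|assumption].
    apply (uc s); [assumption|].
    exact (prec_trans (maximal_parts_above omg gm pt mx pn zn) (lub_l (parts_lub omg pt))). }
  assert (h : rsum (fun e => 0 + gv w * snd e) l <= rsum (fun e => snd e * gv (fst e)) l).
  { apply rsum_le. intros [u c] hu. destruct (lower u c hu) as [c0 hw]. simpl. nra. }
  rewrite rsum_lin, sum1 in h.
  assert (z0 : rsum (fun _ : V * R => 0) l = 0).
  { clear. induction l; simpl; [reflexivity|unfold rsum in *; lra]. }
  lra.
Qed.
End Global.

(** * Steepest descent *)

(** The chosen minimizer may also lie above [w]. Then it is in [K] and ties with [w], so [w] is
    minimal on its own ideal and [steepest_step] applies with [v] equal to [w]. *)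
Lemma steepest_layer V (adj ori : V -> V -> Prop) (gdom : V -> Prop) (gv : V -> R) :
  oriented_modular_graph adj ori ->
  locally_submodular adj ori gdom gv -> locally_submodular adj (flip ori) gdom gv ->
  (forall a b, gdom a -> gdom b -> exists L, path adj ori gdom a b L) ->
  (forall alpha x L, exists rho : V -> nat, forall a b, gdom a -> gdom b ->
    (gdist adj x a <= L)%nat -> (gdist adj x b <= L)%nat ->
    alpha <= gv a -> gv a < gv b -> (rho a < rho b)%nat) ->
  forall K w v, convex adj K -> up_closed ori K ->
  K w -> gdom w -> (forall z, K z -> gdom z -> gv w <= gv z) ->
  gdom v -> cmp ori w v -> (forall z, gdom z -> cmp ori w z -> gv v <= gv z) ->
  upset (flip ori) K v /\ forall z, upset (flip ori) K z -> gdom z -> gv v <= gv z.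
Proof.
intros omg sF sI conn rk K w v cv uc kw gw minw dv wv minv.
destruct wv as [wv|vw].
- assert (kv : K v) by exact (uc _ _ kw wv).
  assert (h1 := minw v kv dv).
  assert (h2 : gv v <= gv w) by (apply minv; [assumption|left; apply prec_refl]).
  split; [apply upset_incl, kv|]. intros z kz gz.
  assert (gv w <= gv z); [|lra].
  apply (@steepest_step V adj ori omg gdom gv sF sI conn rk K w w); auto using prec_refl.
  intros y gy yw. assert (gv v <= gv y); [|lra]. apply minv; [assumption|right; exact yw].
- split; [exists w; split; [assumption|apply prec_flip, vw]|].
  apply (@steepest_step V adj ori omg gdom gv sF sI conn rk K w v); auto.
  intros z gz zw. apply minv; [assumption|right; exact zw].
Qed.

Lemma ball_finite V (adj ori : V -> V -> Prop) : oriented_modular_graph adj ori ->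
  locally_finite adj -> forall x n, exists l, forall v, (gdist adj x v <= n)%nat -> In v l.
Proof.
intros omg lf x n. induction n as [|n [l hl]].
- exists (x :: nil). intros v hv. left. apply (gdist_eq0 omg). lia.
- assert (nb : exists l', forall a b, In a l -> adj a b -> In b l').
  { clear hl. induction l as [|a l [l' h]].
    - exists nil. intros a b [].
    - destruct (lf a) as [la ha]. exists (la ++ l'). intros a' b [<-|h1] h2; apply in_app_iff; eauto. }
  destruct nb as [l' hl']. exists (l ++ l'). intros v hv. apply in_app_iff.
  destruct (Nat.le_gt_cases (gdist adj x v) n) as [h|h]; [left; auto|right].
  assert (e : gdist adj v x = S n) by (rewrite (gdist_sym omg); lia).
  destruct (gdist_toward omg e) as [c [vc cx]].
  apply (hl' c); [|exact (adj_sym omg vc)]. apply hl. rewrite (gdist_sym omg). lia.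
Qed.

(** With local finiteness the rank counts smaller values in a finite list covering the ball; with a
    discrete image it is an integer part of [(gv v - alpha) / eps]. *)
Lemma value_rank_exists V (adj ori : V -> V -> Prop) (gdom : V -> Prop) (gv : V -> R) :
  oriented_modular_graph adj ori -> locally_finite adj \/ discrete_image gdom gv ->
  forall alpha x L, exists rho : V -> nat, forall a b, gdom a -> gdom b ->
    (gdist adj x a <= L)%nat -> (gdist adj x b <= L)%nat ->
    alpha <= gv a -> gv a < gv b -> (rho a < rho b)%nat.
Proof.
intros omg [lf|[eps [e0 ds]]] alpha x L.
- destruct (ball_finite omg lf x L) as [l hl].
  set (below := fun b v => if Rlt_dec (gv v) (gv b) then true else false).
  exists (fun b => length (filter (below b) l)). intros a b _ _ ha _ _ ab.
  assert (ia := hl a ha).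
  assert (mono : forall v, below a v = true -> below b v = true).
  { intros v. unfold below. destruct (Rlt_dec (gv v) (gv a)), (Rlt_dec (gv v) (gv b)); auto. lra. }
  assert (le1 : forall k, (length (filter (below a) k) <= length (filter (below b) k))%nat).
  { induction k as [|v k IH]; simpl; [lia|]. assert (mv := mono v).
    destruct (below a v), (below b v); simpl; lia. }
  assert (na : below a a = false) by (unfold below; destruct (Rlt_dec (gv a) (gv a)); [lra|reflexivity]).
  assert (yb : below b a = true) by (unfold below; destruct (Rlt_dec (gv a) (gv b)); [reflexivity|lra]).
  destruct (in_split _ _ ia) as [l1 [l2 ->]].
  rewrite !filter_app, !length_app. simpl. rewrite na, yb.
  simpl. assert (x1 := le1 l1). assert (x2 := le1 l2). lia.
- exists (fun v => Z.to_nat (up ((gv v - alpha) / eps))). intros a b ga gb _ _ ha hab.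
  assert (gap : gv a + eps < gv b).
  { apply Rnot_le_lt. intros h. assert (gv b = gv a); [|lra]. apply ds; auto. lra. }
  assert (h : (gv a - alpha) / eps + 1 <= (gv b - alpha) / eps).
  { replace ((gv a - alpha) / eps + 1) with ((gv a - alpha + eps) / eps) by (field; lra).
    apply Rmult_le_compat_r; [left; apply Rinv_0_lt_compat; lra|lra]. }
  assert (h0 : 0 <= (gv a - alpha) / eps) by (apply Rle_mult_inv_pos; lra).
  destruct (archimed ((gv a - alpha) / eps)) as [a1 a2].
  destruct (archimed ((gv b - alpha) / eps)) as [b1 b2].
  assert (p : (0 < up ((gv a - alpha) / eps))%Z) by (apply lt_IZR; lra).
  assert (q : (up ((gv a - alpha) / eps) < up ((gv b - alpha) / eps))%Z) by (apply lt_IZR; lra).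
  lia.
Qed.

Lemma dom_path V (adj ori : V -> V -> Prop) (gdom : V -> Prop) :
  delta'_connected ori gdom ->
  forall a b, gdom a -> gdom b -> exists L, path adj ori gdom a b L.
Proof.
intros dc a b ga gb. destruct (classic (a = b)) as [<-|ne].
{ exists 0%nat. apply path_nil, ga. }
assert (r := dc a b ga gb ne). clear ne. apply clos_rt_rt1n in r.
revert ga. induction r as [a|a c b [_ [gc cm]] r IH]; intros ga.
- exists 0%nat. apply path_nil, ga.
- destruct (IH gb gc) as [L p]. exists (gdist adj a c + L)%nat.
  apply path_cons with c L; auto.
  destruct cm as [h|h]; [left|right]; apply h.
Qed.

Lemma walk_snoc T (E : T -> T -> Prop) a b n : walk E a b (S n) ->
  exists c, walk E a c n /\ E c b.
Proof.
intros w. remember (S n) as k eqn:hk. revert n hk.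
induction w as [a|a c b k e w IH]; intros n hk; [discriminate|].
injection hk as ->. destruct n as [|n].
- inversion w; subst. exists a. split; [constructor|assumption].
- destruct (IH n eq_refl) as [f [w' e']]. exists f. split; [|assumption].
  eapply walk_cons; eassumption.
Qed.

Section Descent.
Variable V : Type.
Variables adj ori : V -> V -> Prop.
Variable gdom : V -> Prop.
Variable gv : V -> R.
Hypothesis omg : oriented_modular_graph adj ori.
Hypothesis wo : well_oriented ori.
Hypothesis Lc : L_convex ori gdom gv.
Hypothesis fin : locally_finite adj \/ discrete_image gdom gv.

(** The invariant of the descent. Walks of exactly [i] steps suffice, since runs are compared with a
    walk of given length to an optimum. *)
Definition minimizes_ball (x : V) (i : nat) (v : V) : Prop :=
  exists K, convex adj K /\ half_closed ori K /\ K v /\ gdom v /\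
    (forall z, K z -> gdom z -> gv v <= gv z) /\
    (forall y, walk (delta_adj ori) x y i -> K y).

Lemma FI_cmp w z : FI ori w z <-> cmp ori w z.
Proof.
unfold FI, Fset, Iset, cmp. split; intros [h|h]; auto; [left|right]; apply h.
Qed.

Lemma minimizes_ball_start x : is_min_on gdom gv (Fset ori x) x \/ is_min_on gdom gv (Iset ori x) x ->
  minimizes_ball x 0 x.
Proof.
intros [[_ [gx mn]]|[_ [gx mn]]].
- exists (prec ori x). split; [apply (filter_convex omg)|split; [left|split]].
  + intros a b; apply prec_trans.
  + apply prec_refl.
  + split; [assumption|split].
    * intros z h; apply mn. apply wo, h.
    * intros y w. inversion w; subst. apply prec_refl.
- exists (fun y => prec ori y x). split; [apply (ideal_convex omg)|split; [right|split]].
  + intros a b h1 h2. apply prec_flip in h2. exact (prec_trans h2 h1).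
  + apply prec_refl.
  + split; [assumption|split].
    * intros z h; apply mn. apply wo, h.
    * intros y w. inversion w; subst. apply prec_refl.
Qed.

Lemma minimizes_ball_step x i w v : minimizes_ball x i w ->
  is_min_on gdom gv (FI ori w) v -> minimizes_ball x (S i) v.
Proof.
intros [K [cv [hc [kw [gw [minw ball]]]]]] [wv [dv minv]].
assert (sF := L_convex_filters omg wo Lc). assert (sI := L_convex_ideals omg wo Lc).
assert (conn := dom_path adj (proj1 Lc)). assert (rk := value_rank_exists omg fin).
apply FI_cmp in wv.
assert (minv' : forall z, gdom z -> cmp ori w z -> gv v <= gv z).
{ intros z gz c. apply minv; [apply FI_cmp|]; assumption. }
destruct hc as [uc|dc].
- destruct (steepest_layer omg sF sI conn rk cv uc kw gw minw dv wv minv') as [kv minK].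
  exists (upset (flip ori) K). split; [apply (convex_upset (omg_flip omg)), cv|].
  split; [right; apply upset_up_closed|]. split; [assumption|split; [assumption|split; [assumption|]]].
  (* Delta-adjacent vertices have a common upper bound, and it lies in the up-closed [K]; so both
     are in the down-set. *)
  intros y wy. destruct (walk_snoc wy) as [b [wb [_ [s [t [_ [[_ bt] [_ yt]]]]]]]].
  exists t. split; [exact (uc _ _ (ball b wb) bt)|apply prec_flip, yt].
- assert (conn' : forall a b, gdom a -> gdom b -> exists L, path adj (flip ori) gdom a b L).
  { intros a b ga gb. destruct (conn a b ga gb) as [L p]. exists L. apply path_flip, p. }
  assert (wv' : cmp (flip ori) w v) by (apply cmp_flip, wv).
  assert (minv'' : forall z, gdom z -> cmp (flip ori) w z -> gv v <= gv z).
  { intros z gz c. apply minv'; [assumption|]. apply cmp_flip, c. }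
  destruct (steepest_layer (omg_flip omg) sI sF conn' rk cv dc kw gw minw dv wv' minv'') as [kv minK].
  change (flip (flip ori)) with ori in kv, minK.
  exists (upset ori K). split; [apply (convex_upset omg), cv|].
  split; [left; apply upset_up_closed|]. split; [assumption|split; [assumption|split; [assumption|]]].
  intros y wy. destruct (walk_snoc wy) as [b [wb [_ [s [t [_ [[sb _] [sy _]]]]]]]].
  exists s. split; [|exact sy]. apply (dc b); [exact (ball b wb)|apply prec_flip, sb].
Qed.

Lemma steps_minimize_ball x s n : minimizes_ball x 0 x -> s 0%nat = x ->
  (forall i, (i < n)%nat -> is_min_on gdom gv (FI ori (s i)) (s (S i))) ->
  minimizes_ball x n (s n).
Proof.
intros h s0 st. induction n as [|n IH]; [rewrite s0; assumption|].
apply minimizes_ball_step with (s n); [apply IH; auto with arith|apply st; auto].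
Qed.

(** If [k < n], the vertex [s k] is minimal on a set that contains [y], yet step [k] still decreases
    the value. *)
Lemma run_length_le_walk x n y k : minimizes_ball x 0 x -> sda_run ori gdom gv x n ->
  opt gdom gv y -> walk (delta_adj ori) x y k -> (n <= k)%nat.
Proof.
intros h [s [s0 st]] [_ [gy oy]] w. apply Nat.nlt_ge. intros lt.
assert (m : minimizes_ball x k (s k)).
{ apply steps_minimize_ball; auto. intros i hi. apply st. lia. }
destruct m as [K [_ [_ [_ [_ [mn ball]]]]]].
destruct (st k lt) as [[_ [g2 m2]] ne].
assert (gk : gdom (s k)).
{ destruct k as [|k]; [rewrite s0; destruct h as [? [_ [_ [_ [g _]]]]]; exact g|].
  destruct (st k) as [[_ [g _]] _]; [lia|exact g]. }
assert (h1 := mn y (ball y w) gy).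
assert (h2 := oy (s (S k)) I g2).
assert (h3 : gv (s (S k)) <= gv (s k)).
{ apply m2; [|assumption]. left. apply wo, prec_refl. }
lra.
Qed.

Lemma delta_connected a b : exists n, walk (delta_adj ori) a b n.
Proof.
assert (w := gdist_min_walk omg a b). exists (gdist adj a b).
revert w. generalize (gdist adj a b). intros n w. induction w as [|a c b n e w IH]; [constructor|].
apply walk_cons with c; [|exact IH].
split; [intros ->; exact (adj_irrefl omg e)|].
destruct (adj_ori omg e) as [o|o]; apply prec_ori in o.
- exists c, a. split; [apply wo, o|]. repeat split; auto using prec_refl.
- exists a, c. split; [apply wo, o|]. repeat split; auto using prec_refl.
Qed.

(** At a stopped vertex the constant sequence meets the invariant for every radius, and Delta-walks
    reach every vertex. *)
Lemma stop_optimal x : gdom x -> sda_stop ori gdom gv x -> opt gdom gv x.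
Proof.
intros gx [y [[_ [_ my]] e]].
assert (mx : is_min_on gdom gv (FI ori x) x).
{ split; [left; apply wo, prec_refl|split; [assumption|]]. intros z h1 h2. rewrite e. auto. }
assert (st : minimizes_ball x 0 x).
{ apply minimizes_ball_start. left. destruct mx as [_ [_ m]].
  split; [apply wo, prec_refl|split; [assumption|]]. intros z h; apply m; left; exact h. }
split; [exact I|split; [assumption|]]. intros z _ gz.
destruct (delta_connected x z) as [n w].
assert (h := @steps_minimize_ball x (fun _ => x) n st eq_refl (fun _ _ => mx)).
destruct h as [K [_ [_ [_ [_ [mn ball]]]]]]. auto.
Qed.

Lemma sda_step_delta_adj a b : sda_step ori gdom gv a b -> delta_adj ori a b.
Proof.
intros [[c _] ne]. split; [intros ->; auto|].
destruct c as [h|h]; assert (p := proj1 h).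
- exists a, b. split; [exact h|]. repeat split; auto using prec_refl.
- exists b, a. split; [exact h|]. repeat split; auto using prec_refl.
Qed.

Lemma delta_adj_sym a b : delta_adj ori a b -> delta_adj ori b a.
Proof. intros [ne [u [v [h1 [h2 h3]]]]]. split; [auto|]. exists u, v; auto. Qed.
End Descent.

Theorem theorem4p7 (V : Type) (adj ori : V -> V -> Prop)
  (gdom : V -> Prop) (gv : V -> R) (x : V) :
  oriented_modular_graph adj ori ->
  well_oriented ori ->
  L_convex ori gdom gv ->
  (locally_finite adj \/ discrete_image gdom gv) ->
  gdom x ->
  (forall n, sda_run ori gdom gv x n ->
     forall y k, opt gdom gv y -> ddist ori x y k -> (n <= k + 2)%nat) /\
  ((is_min_on gdom gv (Fset ori x) x \/ is_min_on gdom gv (Iset ori x) x) ->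
     (forall n, sda_run ori gdom gv x n ->
        forall y k, opt gdom gv y -> ddist ori x y k -> (n <= k)%nat) /\
     (forall n, sda_terminated ori gdom gv x n ->
        exists y, opt gdom gv y /\ ddist ori x y n)).
Proof.
intros omg wo Lc fin gx. split.
- intros n [s [s0 st]] y k oy [w _]. destruct n as [|n]; [lia|].
  assert (st0 : sda_step ori gdom gv x (s 1%nat)) by (rewrite <- s0; apply st; lia).
  (* If the first step goes up, the filter of [s 1] is contained in that of [x], so [s 1] is minimal
     on its own filter; dually for a step down. *)
  assert (start : minimizes_ball adj ori gdom gv (s 1%nat) 0 (s 1%nat)).
  { apply minimizes_ball_start; auto. destruct st0 as [[[h|h] [g1 m1]] _]; [left|right].
    - split; [apply wo, prec_refl|split; [assumption|]]. intros z hz gz.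
      apply m1; [|assumption]. left. apply wo. exact (prec_trans (proj1 h) (proj1 hz)).
    - split; [apply wo, prec_refl|split; [assumption|]]. intros z hz gz.
      apply m1; [|assumption]. right. apply wo. exact (prec_trans (proj1 hz) (proj1 h)). }
  assert (w' : walk (delta_adj ori) (s 1%nat) y (S k)).
  { eapply walk_cons; [|exact w]. apply delta_adj_sym. exact (sda_step_delta_adj st0). }
  (* The run has [S n] steps: the first one, and [n] more that are bounded by the walk from [s 1]
     back to [x] and on to [y]. *)
  assert (n <= S k)%nat; [|lia].
  refine (run_length_le_walk omg wo Lc fin start _ oy w').
  exists (fun i => s (S i)). split; [reflexivity|]. intros i hi. apply st. lia.
- intros mx. assert (start := minimizes_ball_start omg wo mx).
  split.
  + intros n r y k oy [w _]. exact (run_length_le_walk omg wo Lc fin start r oy w).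
  + intros n [s [s0 [st stop]]].
    assert (gn : gdom (s n)).
    { destruct n as [|n]; [rewrite s0; exact gx|].
      destruct (st n) as [[_ [g _]] _]; [lia|exact g]. }
    assert (on := stop_optimal omg wo Lc fin gn stop).
    exists (s n). split; [assumption|split].
    (* Each step is a Delta-edge, so the run itself is a walk of length [n] to an optimum. *)
    * rewrite <- s0. clear - st wo. induction n as [|n IH]; [constructor|].
      replace (S n) with (n + 1)%nat at 2 by lia. eapply walk_app.
      { apply IH. intros i hi. apply st. lia. }
      eapply walk_cons; [|constructor]. apply (@sda_step_delta_adj V ori gdom gv), st. lia.
    * intros m w. refine (run_length_le_walk omg wo Lc fin start _ on w).
      exists s. auto.
Qed.
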